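(* The \(\mathcal{L}\)-tree recognition problem for Lexicographic Depth First Search (LDFS) can be solved in polynomial time: there is an algorithm that, given a connected graph \(G=(V,E)\) and a spanning tree \(T\) of \(G\), decides in time polynomial in \(|V|+|E|\) whether there exists an LDFS ordering \(\sigma\) of \(G\) whose \(\mathcal{L}\)-tree is \(T\).
   Context: All graphs are finite, simple, undirected and connected. An LDFS ordering of \(G\) is any vertex ordering \(\sigma=(v_1,\dots,v_n)\) produced by the following procedure for some start vertex \(s\) and some tie-breaking: give \(s\) the label \((0)\) and every other vertex the empty label; for \(i=1,\dots,n\), pick an unnumbered vertex \(v\) with lexicographically largest label, set \(v_i:=v\), and prepend the integer \(i\) to the label of every unnumbered neighbor of \(v\). Given a vertex ordering \(\sigma=(v_1,\dots,v_n)\) of a connected graph in which every \(v_i\), \(i\ge 2\), has a neighbor \(v_j\) with \(j<i\), the \(\mathcal{L}\)-tree (last-in tree) of \(\sigma\) is the tree on \(V\) containing, for each \(i\ge 2\), the edge from \(v_i\) to its rightmost neighbor \(v_j\) with \(j<i\). *)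

(* Defs.v *)
From mathcomp Require Import all_boot.
Set Implicit Arguments. Unset Strict Implicit. Unset Printing Implicit Defensive.

Definition simple_graph (n : nat) (G : rel 'I_n) : Prop :=
  symmetric G /\ irreflexive G.

Definition connected_graph (n : nat) (G : rel 'I_n) : Prop :=
  simple_graph G /\ forall x y, connect G x y.

Definition nedges (n : nat) (G : rel 'I_n) : nat :=
  #|[set p : 'I_n * 'I_n | G p.1 p.2 && (p.1 < p.2)%N]|.

Definition spanning_tree (n : nat) (G T : rel 'I_n) : Prop :=
  connected_graph T /\ subrel T G /\ nedges T = n.-1.

Fixpoint lex_le (a b : seq nat) : bool :=
  match a, b with
  | [::], _ => true
  | _ :: _, [::] => false
  | x :: a', y :: b' => (x < y)%N || ((x == y) && lex_le a' b')
  end.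

(* A vertex ordering is a duplicate-free sequence of all vertices.
   Positions are 0-based in Rocq; vertex at position j gets number j+1. *)
Definition vertex_ordering (n : nat) (sigma : seq 'I_n) : bool :=
  uniq sigma && (size sigma == n).

(* Label of vertex u after the first i vertices of sigma have been
   numbered, when the search starts at s: start label (0) for s, empty
   otherwise, and each number j+1 prepended when the vertex numbered j+1
   is a neighbour of u. *)
Definition ldfs_label (n : nat) (G : rel 'I_n) (s : 'I_n) (sigma : seq 'I_n)
    (i : nat) (u : 'I_n) : seq nat :=
  [seq (index w sigma).+1 | w <- rev (take i sigma) & G w u]
    ++ (if u == s then [:: 0] else [::]).

(* sigma is produced by the LDFS procedure for some start vertex s and some
   tie-breaking: at every step i, the chosen vertex sigma_i has a
   lexicographically largest label among the unnumbered vertices. *)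
Definition is_LDFS (n : nat) (G : rel 'I_n) (sigma : seq 'I_n) : Prop :=
  vertex_ordering sigma /\
  exists s : 'I_n, forall i : nat, (i < n)%N ->
    forall u : 'I_n, u \notin take i sigma ->
      lex_le (ldfs_label G s sigma i u) (ldfs_label G s sigma i (nth s sigma i)).

Definition ltree_parent (n : nat) (G : rel 'I_n) (sigma : seq 'I_n) (x y : 'I_n) : bool :=
  let pre := take (index x sigma) sigma in
  [&& y \in pre, G x y & all (fun w => ~~ G x w) (drop (index y sigma).+1 pre)].

Definition ltree (n : nat) (G : rel 'I_n) (sigma : seq 'I_n) : rel 'I_n :=
  fun x y => ltree_parent G sigma x y || ltree_parent G sigma y x.

Definition LDFS_Ltree (n : nat) (G T : rel 'I_n) : Prop :=
  exists sigma : seq 'I_n, is_LDFS G sigma /\ forall x y, ltree G sigma x y = T x y.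

Definition sym_blank : 'I_4 := @Ordinal 4 0 isT.
Definition sym_0 : 'I_4 := @Ordinal 4 1 isT.
Definition sym_1 : 'I_4 := @Ordinal 4 2 isT.
Definition sym_sep : 'I_4 := @Ordinal 4 3 isT.

(* states 'I_(tm_q).+1, start state ord0; moves: 0 = left, 1 = stay,
   2 = right *)
Record TM := {
  tm_q : nat;
  tm_delta : 'I_tm_q.+1 -> 'I_4 -> 'I_tm_q.+1 * 'I_4 * 'I_3;
  tm_acc : 'I_tm_q.+1;
  tm_rej : 'I_tm_q.+1 }.

(* configuration: state, (reversed left part, head symbol, right part) *)
Definition config (M : TM) := ('I_(tm_q M).+1 * (seq 'I_4 * 'I_4 * seq 'I_4))%type.

Definition tm_init (M : TM) (w : seq 'I_4) : config M :=
  (ord0, ([::], head sym_blank w, behead w)).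

Definition tm_step (M : TM) (c : config M) : config M :=
  let: (q, (l, h, r)) := c in
  if (q == @tm_acc M) || (q == @tm_rej M) then c else
  let: (q', a, mv) := @tm_delta M q h in
  if val mv == 0 then (q', (behead l, head sym_blank l, a :: r))
  else if val mv == 1 then (q', (l, a, r))
  else (q', (a :: l, head sym_blank r, behead r)).

Definition tm_run (M : TM) (t : nat) (w : seq 'I_4) : config M :=
  iter t (@tm_step M) (tm_init M w).

Definition bit (b : bool) : 'I_4 := if b then sym_1 else sym_0.

Definition enc_rel (n : nat) (R : rel 'I_n) : seq 'I_4 :=
  [seq bit (R i j) | i <- enum 'I_n, j <- enum 'I_n].

Definition encode (n : nat) (G T : rel 'I_n) : seq 'I_4 :=
  enc_rel G ++ sym_sep :: enc_rel T.

(* Main.v *)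
Require Import Defs.
From mathcomp Require Import all_boot.
From mathcomp Require Import zify.
From Stdlib Require Import FunctionalExtensionality.
Set Implicit Arguments. Unset Strict Implicit. Unset Printing Implicit Defensive.

(* Root T at s.  The visited neighbours of an unvisited vertex are among its
   ancestors, so the choices that a search makes at different vertices of T do
   not influence each other, and T is the L-tree of an LDFS ordering starting at
   s if and only if every edge of G joins an ancestor to a descendant and no
   descendant x of a vertex c has a larger label than c when c is visited: if an
   ancestor a of c is adjacent to x but not to c, then some d strictly between a
   and c is adjacent to c but not to x.  This is tested for every s; a is an
   ancestor of x if removing a separates x from s in T.

   The Turing machine is compiled from a language of bounded loops over registers
   and bit arrays, all of whose programs take polynomial time.  Its tape is
   divided into blocks, one per input symbol; a register is a mark on a block and
   an array is one bit in each block. *)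

(** * Machines with two exits *)

(** The check compares a vertex only with its own descendants, although a search chooses among all
    unvisited vertices. This is enough because [T] does not prescribe the order in which its
    branches are entered: it has only to be shown that some vertex of largest label has a visited
    parent. Nor does the comparison depend on the history of the search, since the ancestors of a
    vertex are numbered in their order along the tree. Ancestors are tested by reachability because
    this is an iterated first-order formula; the program never computes a parent function. The step
    bound has to hold for a concrete machine with four tape symbols. Every construct of the language
    therefore carries a cost that depends on the number of blocks only, and no running time has to
    be derived from the meaning of a program. *)

Definition tape := (seq 'I_4 * 'I_4 * seq 'I_4)%type.

Definition mleft : 'I_3 := @Ordinal 3 0 isT.
Definition mstay : 'I_3 := @Ordinal 3 1 isT.
Definition mright : 'I_3 := @Ordinal 3 2 isT.

Definition move_tape (mv : 'I_3) (l r : seq 'I_4) (a : 'I_4) : tape :=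
  if val mv == 0 then (behead l, head sym_blank l, a :: r)
  else if val mv == 1 then (l, a, r)
  else (a :: l, head sym_blank r, behead r).

(** The exits lie outside the state type, so that machines are composed by redirecting exits over
    sum types; states are numbered only in the final translation to a [TM]. *)
Record mach := Mach {
  mstate : finType;
  mstart : mstate;
  mdelta : mstate -> 'I_4 -> (mstate + bool) * 'I_4 * 'I_3 }.

Definition mstep (m : mach) (c : (mstate m + bool) * tape) :=
  match c with
  | (inl q, (l, h, r)) =>
      let: (x, a, mv) := mdelta q h in (x, move_tape mv l r a)
  | _ => c
  end.

Definition mruns (m : mach) (tp : tape) (b : bool) (tp' : tape) (t : nat) :=
  exists2 k, k <= t & iter k (@mstep m) (inl (mstart m), tp) = (inr b, tp').

Lemma iter_mstep_exit (m : mach) k b tp :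
  iter k (@mstep m) (inr b, tp) = (inr b, tp).
Proof. by elim: k => //= k ->. Qed.

Definition relabel (A B : Type) (e : A -> B) (ex : bool -> B + bool)
    (x : A + bool) : B + bool :=
  match x with inl q => inl (e q) | inr b => ex b end.

(** All combinators rest on this simulation. The bound [k' <= k] is an inequality because exits are
    absorbing: the run of [a] may idle after its exit, while in [m] the redirected exit may already
    be the start of another component. *)
Lemma mstep_embed (a m : mach) (e : mstate a -> mstate m) ex k q tp b tp' :
  (forall q h, mdelta (e q) h
     = let: (x, c, mv) := mdelta q h in (relabel e ex x, c, mv)) ->
  iter k (@mstep a) (inl q, tp) = (inr b, tp') ->
  exists2 k', k' <= k & iter k' (@mstep m) (inl (e q), tp) = (ex b, tp').
Proof.
move=> He; elim: k q tp => [//|k IH] q [[l h] r].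
rewrite iterSr /=; case E: (mdelta q h) => [[x c] mv].
have S1 : mstep (inl (e q), (l, h, r)) = (relabel e ex x, move_tape mv l r c).
  by rewrite /= He E.
case: x S1 {E} => [q'|b'] S1 H.
  case: (IH _ _ H) => k' lek E; exists k'.+1 => //.
  by rewrite iterSr S1.
rewrite iter_mstep_exit in H; case: H => <- <-; exists 1 => //=.
Qed.

Definition act (g : 'I_4 -> bool * 'I_4 * 'I_3) : mach :=
  @Mach unit tt (fun _ h => let: (b, a, mv) := g h in (inr b, a, mv)).

Definition ite_delta (a p q : mach) (x : mstate a + mstate p + mstate q) h :
    (mstate a + mstate p + mstate q + bool) * 'I_4 * 'I_3 :=
  match x with
  | inl (inl y) => let: (x', c, mv) := mdelta y h in
      (relabel (fun y => inl (inl y))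
         (fun b => inl (if b then inl (inr (mstart p)) else inr (mstart q))) x',
       c, mv)
  | inl (inr y) => let: (x', c, mv) := mdelta y h in
      (relabel (fun y => inl (inr y)) inr x', c, mv)
  | inr y => let: (x', c, mv) := mdelta y h in
      (relabel (fun y => inr y) inr x', c, mv)
  end.

Definition ite (a p q : mach) : mach :=
  @Mach (mstate a + mstate p + mstate q)%type (inl (inl (mstart a)))
    (@ite_delta a p q).

Definition loop_delta (a p : mach) (x : mstate a + mstate p) h :
    (mstate a + mstate p + bool) * 'I_4 * 'I_3 :=
  match x with
  | inl y => let: (x', c, mv) := mdelta y h in
      (relabel inl (fun b => if b then inr true else inl (inr (mstart p))) x',
       c, mv)
  | inr y => let: (x', c, mv) := mdelta y h in
      (relabel inr (fun b => if b then inl (inl (mstart a)) else inr false) x',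
       c, mv)
  end.

(* Run [a]; exit with [true] if it succeeds. Otherwise run [p]; exit with
   [false] if it fails, start again if it succeeds. *)
Definition loopm (a p : mach) : mach :=
  @Mach (mstate a + mstate p)%type (inl (mstart a)) (@loop_delta a p).

Definition seqm a b := ite a b b.

(* [R x tp] says that the tape [tp] represents the abstract state [x]. *)
Record gruns X (R : X -> tape -> Prop) (m : mach) (x : X) (b : bool)
    (y : X) (t : nat) : Prop := Gruns {
  grunsP : forall tp, R x tp -> exists2 tp', R y tp' & mruns m tp b tp' t }.

Section Rules.
Variables (X : Type) (R : X -> tape -> Prop).
Implicit Types (a p q m : mach) (x z u : X).

Lemma gruns_le m x b y t t' : t <= t' -> gruns R m x b y t -> gruns R m x b y t'.
Proof.
move=> le_t [H]; split=> tp /H[tp' Rtp' [k lek E]]; exists tp' => //.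
by exists k => //; apply: leq_trans le_t.
Qed.

Lemma gruns_ite a p q x b y b' z t1 t2 t :
  gruns R a x b y t1 -> gruns R (if b then p else q) y b' z t2 ->
  t1 + t2 <= t -> gruns R (ite a p q) x b' z t.
Proof.
move=> [H1] [H2] let_; split=> tp /H1[tp1 /H2[tp2 Rz [k2 lek2 E2]] [k1 lek1 E1]].
exists tp2 => //.
have [|k1' lek1' E1'] := mstep_embed (m := ite a p q)
   (e := fun y => inl (inl y))
   (ex := fun b => inl (if b then inl (inr (mstart p)) else inr (mstart q))) _ E1.
  by move=> q' h.
have [k2' lek2' E2'] : exists2 k', k' <= k2 & iter k' (@mstep (ite a p q))
   (inl (if b then inl (inr (mstart p)) else inr (mstart q)), tp1) = (inr b', tp2).
  case: b E2 {E1 E1' H1 H2} => E2.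
    by apply: (mstep_embed (m := ite a p q) (e := fun y => inl (inr y)) (ex := inr) _ E2).
  by apply: (mstep_embed (m := ite a p q) (e := fun y => inr y) (ex := inr) _ E2).
exists (k2' + k1'); first by lia.
by rewrite iterD E1' E2'.
Qed.

Lemma gruns_loop_exit a p x y t :
  gruns R a x true y t -> gruns R (loopm a p) x true y t.
Proof.
move=> [H1]; split=> tp /H1[tp1 Ry [k1 lek1 E1]]; exists tp1 => //.
have [|k1' lek1' E1'] := mstep_embed (m := loopm a p) (e := inl)
  (ex := fun b => if b then inr true else inl (inr (mstart p))) _ E1 => //.
by exists k1' => //; lia.
Qed.

Lemma loop_round a p tp tp1 tp2 b t1 t2 :
  mruns a tp false tp1 t1 -> mruns p tp1 b tp2 t2 ->
  exists2 k, k <= t1 + t2 &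
    iter k (@mstep (loopm a p)) (inl (inl (mstart a)), tp)
      = (if b then inl (inl (mstart a)) else inr false, tp2).
Proof.
move=> [k1 lek1 E1] [k2 lek2 E2].
have [|k1' lek1' E1'] := mstep_embed (m := loopm a p) (e := inl)
  (ex := fun b => if b then inr true else inl (inr (mstart p))) _ E1 => //.
have [|k2' lek2' E2'] := mstep_embed (m := loopm a p) (e := inr)
  (ex := fun b => if b then inl (inl (mstart a)) else inr false) _ E2 => //.
exists (k2' + k1'); first by lia.
by rewrite iterD E1' E2'.
Qed.

Lemma gruns_loop_fail a p x y z t1 t2 t :
  gruns R a x false y t1 -> gruns R p y false z t2 -> t1 + t2 <= t ->
  gruns R (loopm a p) x false z t.
Proof.
move=> [H1] [H2] let_; split=> tp /H1[tp1 /H2[tp2 Rz M2] M1]; exists tp2 => //.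
have [k lek E] := loop_round M1 M2.
by exists k => //; lia.
Qed.

Lemma gruns_loop_next a p x y z b u t1 t2 t3 t :
  gruns R a x false y t1 -> gruns R p y true z t2 ->
  gruns R (loopm a p) z b u t3 -> t1 + t2 + t3 <= t ->
  gruns R (loopm a p) x b u t.
Proof.
move=> [H1] [H2] [H3] let_; split=> tp /H1[tp1 /H2[tp2 /H3[tp3 Ru [k3 lek3 E3]] M2] M1].
exists tp3 => //.
have [k lek E] := loop_round M1 M2.
exists (k3 + k); first by lia.
by rewrite iterD E.
Qed.

Lemma gruns_seq a p x b y b' z t1 t2 t :
  gruns R a x b y t1 -> gruns R p y b' z t2 ->
  t1 + t2 <= t -> gruns R (seqm a p) x b' z t.
Proof. by move=> H1 H2; apply: (gruns_ite H1); case: b H1. Qed.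

Definition idm b := act (fun h => (b, h, mstay)).

Lemma gruns_id b x : gruns R (idm b) x b x 1.
Proof. by split=> -[[l h] r] Rx; exists (l, h, r) => //; exists 1. Qed.

(** The verdict of [a] survives the run of [h] only in the control state, hence the two copies of
    [h]. *)
Definition retm a h := ite a (seqm h (idm true)) (seqm h (idm false)).

Lemma gruns_ret a h x b y b' z t1 t2 t :
  gruns R a x b y t1 -> gruns R h y b' z t2 -> t1 + t2 < t ->
  gruns R (retm a h) x b z t.
Proof.
move=> H1 H2 lt; apply: (gruns_ite (t2 := t2.+1) H1); last by lia.
by case: b H1 => _; apply: (gruns_seq H2 (gruns_id _ _)); rewrite addn1.
Qed.

End Rules.

(** * From machines with exits to Turing machines *)

Section ToTM.
Variable m : mach.
Let S : finType := (mstate m + bool)%type.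

(** A [TM] has to start in [ord0], which is therefore reserved for [mstart m]; the other states are
    shifted by one. *)
Definition code (x : S) : 'I_#|S|.+1 :=
  if x == inl (mstart m) then ord0 else lift ord0 (enum_rank x).
Definition decode (i : 'I_#|S|.+1) : S :=
  if unlift ord0 i is Some j then enum_val j else inl (mstart m).

Lemma codeK : cancel code decode.
Proof.
move=> x; rewrite /code /decode; case: eqP => [->|_]; first by rewrite unlift_none.
by rewrite liftK enum_rankK.
Qed.

Definition TM_of : TM :=
  @Build_TM #|S|
    (fun i h => match decode i with
                | inl q => let: (x, a, mv) := mdelta q h in (code x, a, mv)
                | inr b => (i, h, mstay)
                end)
    (code (inr true)) (code (inr false)).

Lemma TM_acc_rej : tm_acc TM_of != tm_rej TM_of.
Proof. by apply/eqP => /(can_inj codeK). Qed.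

Lemma TM_step (c : S * tape) :
  @tm_step TM_of (code c.1, c.2) = (code (mstep c).1, (mstep c).2).
Proof.
case: c => [[q|b] [[l h] r]] /=; last first.
  by case: b; rewrite eqxx ?orbT.
rewrite !(inj_eq (can_inj codeK)) /= codeK.
by case: (mdelta q h) => [[x a] mv] /=; rewrite /move_tape; do 2 case: ifP => //.
Qed.

(** Exits are fixed points of the step function, so the state after exactly [t] steps is the one
    reached at the exit, at most [t] steps from the start. *)
Lemma TM_run_exit w b tp t :
  mruns m ([::], head sym_blank w, behead w) b tp t ->
  (tm_run TM_of t w).1 = if b then tm_acc TM_of else tm_rej TM_of.
Proof.
move=> [k lek E].
have sim c j : iter j (@tm_step TM_of) (code c.1, c.2)
    = (code (iter j (@mstep m) c).1, (iter j (@mstep m) c).2).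
  by elim: j => //= j ->; rewrite TM_step.
have E0 : tm_init TM_of w = (code (inl (mstart m)), ([::], head sym_blank w, behead w)).
  by rewrite /code eqxx.
rewrite /tm_run E0 (sim (_, _)) -(subnK lek) iterD E iter_mstep_exit /=.
by case: b {E}.
Qed.

End ToTM.

(** * Elementary machines on tapes indexed by natural numbers *)

(* [f] is the tape content from cell 0 on and [i] the head position; cells to
   the left of cell 0 are never visited. *)
Definition trepr (fi : (nat -> 'I_4) * nat) (tp : tape) :=
  let: (f, i) := fi in let: (l, h, r) := tp in
  [/\ h = f i, forall k, k < i -> nth sym_blank l k = f (i - k.+1)
    & forall k, nth sym_blank r k = f (i.+1 + k)].

Definition upd (f : nat -> 'I_4) i a j := if j == i then a else f j.

Lemma gruns_act g f i b a (mv : 'I_3) :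
  g (f i) = (b, a, mv) -> (val mv == 0 -> 0 < i) ->
  gruns trepr (act g) (f, i) b
    (upd f i a, if val mv == 0 then i.-1 else if val mv == 1 then i else i.+1) 1.
Proof.
move=> E Hmv; split=> -[[l h] r] [Eh El Er]; exists (move_tape mv l r a); last first.
  by exists 1 => //=; rewrite Eh E.
rewrite /move_tape /upd; move: Hmv; case: ifP => [_ /(_ isT) i0|_ _].
  split.
  - by rewrite -nth0 El // subn1; case: eqP => //; lia.
  - by move=> k lek; rewrite nth_behead El; [case: eqP; [lia|move=> _; congr f; lia]|lia].
  - by case=> [|k] /=; [rewrite addn0 prednK // eqxx|rewrite Er; case: eqP; [lia|move=> _; congr f; lia]].
case: ifP => _; split.
- by rewrite eqxx.
- by move=> k lek; rewrite El //; case: eqP => //; lia.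
- by move=> k; rewrite Er //; case: eqP => //; lia.
- by rewrite -nth0 Er addn0; case: eqP => //; lia.
- case=> [|k] lek /=; first by rewrite subn1 eqxx.
  by rewrite El // subSS; case: eqP => //; lia.
- by move=> k; rewrite nth_behead Er; case: eqP; [lia|move=> _; congr f; lia].
Qed.

Lemma upd_id f i : upd f i (f i) = f.
Proof. by apply: functional_extensionality => j; rewrite /upd; case: eqP => [->|]. Qed.

Definition testm (P : pred 'I_4) := act (fun h => (P h, h, mstay)).
Definition putm a mv := act (fun _ => (true, a, mv)).
Definition step1 mv := act (fun h => (true, h, mv)).

Lemma gruns_test P f i : gruns trepr (testm P) (f, i) (P (f i)) (f, i) 1.
Proof.
have H : gruns trepr (testm P) (f, i) (P (f i)) (upd f i (f i), i) 1.
  by apply: (gruns_act (mv := mstay)).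
by rewrite upd_id in H.
Qed.

Lemma gruns_put a f i : gruns trepr (putm a mstay) (f, i) true (upd f i a, i) 1.
Proof. by apply: (gruns_act (mv := mstay)). Qed.

Lemma gruns_putl a f i : gruns trepr (putm a mleft) (f, i.+1) true (upd f i.+1 a, i) 1.
Proof. by apply: (gruns_act (mv := mleft)). Qed.

Lemma gruns_stepr f i : gruns trepr (step1 mright) (f, i) true (f, i.+1) 1.
Proof.
have H : gruns trepr (step1 mright) (f, i) true (upd f (i) (f (i)), i.+1) 1.
  by apply: (gruns_act (mv := mright)).
by rewrite upd_id in H.
Qed.

Lemma gruns_stepl f i : gruns trepr (step1 mleft) (f, i.+1) true (f, i) 1.
Proof.
have H : gruns trepr (step1 mleft) (f, i.+1) true (upd f (i.+1) (f (i.+1)), i) 1.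
  by apply: (gruns_act (mv := mleft)).
by rewrite upd_id in H.
Qed.

Fixpoint moves mv k := if k is k'.+1 then seqm (step1 mv) (moves mv k') else idm true.

Lemma gruns_movr k f i : gruns trepr (moves mright k) (f, i) true (f, i + k) k.+1.
Proof.
elim: k i => [|k IH] i /=; first by rewrite addn0; apply: gruns_id.
by rewrite -addSnnS; apply: (gruns_seq (gruns_stepr f i) (IH _)).
Qed.

Lemma gruns_movl k f i : gruns trepr (moves mleft k) (f, i + k) true (f, i) k.+1.
Proof.
elim: k => [|k IH] /=; first by rewrite addn0; apply: gruns_id.
by rewrite addnS; apply: (gruns_seq (gruns_stepl f (i + k)) IH).
Qed.

Definition isblank : pred 'I_4 := pred1 sym_blank.

Definition scan mv := loopm (testm isblank) (moves mv 1).

Lemma gruns_scanr f i k :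
  (forall j, i <= j < i + k -> f j != sym_blank) -> f (i + k) = sym_blank ->
  gruns trepr (scan mright) (f, i) true (f, i + k) (3 * k).+1.
Proof.
elim: k i => [|k IH] i Hnb Hb.
  rewrite addn0 in Hb *; apply: gruns_loop_exit.
  by have := @gruns_test isblank f i; rewrite /isblank /= Hb.
have T := @gruns_test isblank f i.
have E : isblank (f i) = false by apply/negbTE/Hnb; lia.
rewrite E in T.
apply: (gruns_loop_next T (gruns_movr 1 f i) (t3 := (3 * k).+1)); last by lia.
rewrite addn1 -addSnnS; apply: IH; last by rewrite addSnnS.
by move=> j Hj; apply: Hnb; lia.
Qed.

Lemma gruns_scanl f i k :
  (forall j, i < j <= i + k -> f j != sym_blank) -> f i = sym_blank ->
  gruns trepr (scan mleft) (f, i + k) true (f, i) (3 * k).+1.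
Proof.
move=> Hnb Hb; elim: k Hnb => [|k IH] Hnb.
  rewrite addn0; apply: gruns_loop_exit.
  by have := @gruns_test isblank f i; rewrite /isblank /= Hb.
have T := @gruns_test isblank f (i + k.+1).
have E : isblank (f (i + k.+1)) = false by apply/negbTE/Hnb; lia.
rewrite E in T.
have M := gruns_movl 1 f (i + k); rewrite addn1 -addnS in M.
apply: (gruns_loop_next T M (t3 := (3 * k).+1)); last by lia.
by apply: IH => j Hj; apply: Hnb; lia.
Qed.

Definition rd t :=
  seqm (moves mright t) (retm (testm (pred1 sym_1)) (moves mleft t)).

Definition wr t a :=
  seqm (moves mright t) (seqm (putm a mstay) (moves mleft t)).

Lemma gruns_rd t f i :
  gruns trepr (rd t) (f, i) (f (i + t) == sym_1) (f, i) (2 * t + 5).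
Proof.
apply: (gruns_seq (gruns_movr t f i) (t2 := t + 4)); last by lia.
have H := gruns_ret (gruns_test (pred1 sym_1) f (i + t)) (gruns_movl t f i) (t := t + 4).
by apply: H; lia.
Qed.

Lemma gruns_wr t a f i :
  gruns trepr (wr t a) (f, i) true (upd f (i + t) a, i) (2 * t + 5).
Proof.
apply: (gruns_seq (gruns_movr t f i) (t2 := t + 4)); last by lia.
have H := gruns_seq (gruns_put a f (i + t)) (gruns_movl t _ i) (t := t + 4).
by apply: H; lia.
Qed.

(** * Tapes divided into blocks of bits *)

(* The tape consists of [N] blocks of [K] cells between two blanks; cell [t] of
   block [p] holds the bit [v t p], so [v t] is the content of track [t].  The
   head is on the first cell of a block. *)
Section Blocks.
Variables (K N : nat).
Implicit Types (v : nat -> nat -> bool).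

Definition encv v (f : nat -> 'I_4) :=
  [/\ f 0 = sym_blank, f (N * K).+1 = sym_blank
    & forall p t, p < N -> t < K -> f (p * K + t).+1 = bit (v t p)].

Definition vrepr (vp : (nat -> nat -> bool) * nat) tp :=
  exists2 f, encv vp.1 f & trepr (f, (vp.2 * K).+1) tp.

Definition updv v t p b t' p' := if (t' == t) && (p' == p) then b else v t' p'.

Lemma vruns_intro m v p b v' p' t :
  (forall f, encv v f -> exists2 f', encv v' f' &
     gruns trepr m (f, (p * K).+1) b (f', (p' * K).+1) t) ->
  gruns vrepr m (v, p) b (v', p') t.
Proof.
move=> H; split=> tp [f /H[f' Hf' [G]] /G[tp' Rtp' M]].
by exists tp' => //; exists f'.
Qed.

Lemma bit_eq1 b : (bit b == sym_1) = b. Proof. by case: b. Qed.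
Lemma bit_blank b : isblank (bit b) = false. Proof. by case: b. Qed.

Lemma vruns_rd t v p : p < N -> t < K ->
  gruns vrepr (rd t) (v, p) (v t p) (v, p) (2 * K + 5).
Proof.
move=> pN tK; apply: vruns_intro => f Ef; exists f => //.
have [_ _ /(_ p t pN tK) E] := Ef.
have := gruns_rd t f (p * K).+1; rewrite addSn E bit_eq1.
by apply: gruns_le; lia.
Qed.

(** Uniqueness of quotient and remainder; it separates the cells of the tape here and the entries of
    a matrix later. *)
Lemma block_inj p t q s : t < K -> s < K ->
  (p * K + t == q * K + s) = (p == q) && (t == s).
Proof.
move=> tK sK; apply/eqP/andP => [E|[/eqP-> /eqP->] //].
have K0 : 0 < K by lia.
have Epq : p = q.
  by have := congr1 (divn^~ K) E; rewrite !divnMDl // !divn_small // !addn0.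
by move: E; rewrite Epq => /addnI->; rewrite !eqxx.
Qed.

Lemma vruns_wr t b v p : p < N -> t < K ->
  gruns vrepr (wr t (bit b)) (v, p) true (updv v t p b, p) (2 * K + 5).
Proof.
move=> pN tK; apply: vruns_intro => f [E0 EN E].
have pK : p * K + t < N * K by apply: leq_trans (leq_mul pN (leqnn K)); rewrite mulSn; lia.
exists (upd f ((p * K).+1 + t) (bit b)); last first.
  by have := gruns_wr t (bit b) f (p * K).+1; apply: gruns_le; lia.
split=> [||q s qN sK]; rewrite /upd.
- by rewrite addSn.
- by case: eqP => //; lia.
by rewrite addSn eqSS block_inj // /updv E // andbC; case: ifP.
Qed.

Lemma vruns_next v p :
  gruns vrepr (moves mright K) (v, p) true (v, p.+1) K.+1.
Proof.
apply: vruns_intro => f Ef; exists f => //.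
by rewrite mulSnr -addSn; apply: gruns_movr.
Qed.

Lemma vruns_prev v p :
  gruns vrepr (moves mleft K) (v, p.+1) true (v, p) K.+1.
Proof.
apply: vruns_intro => f Ef; exists f => //.
by rewrite mulSnr -addSn; apply: gruns_movl.
Qed.

Hypothesis K0 : 0 < K.

Lemma vruns_end v p : p <= N ->
  gruns vrepr (testm isblank) (v, p) (p == N) (v, p) 1.
Proof.
move=> pN; apply: vruns_intro => f Ef; exists f => //.
have [_ EN E] := Ef.
have := gruns_test isblank f (p * K).+1.
suff -> : isblank (f (p * K).+1) = (p == N) by [].
case: eqP => [->|ne]; first by rewrite EN.
by have := E p 0; rewrite addn0 => ->; rewrite ?bit_blank //; lia.
Qed.

Definition athome := seqm (step1 mleft) (retm (testm isblank) (step1 mright)).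

Lemma vruns_athome v p : p <= N ->
  gruns vrepr athome (v, p) (p == 0) (v, p) 4.
Proof.
move=> pN; apply: vruns_intro => f Ef; exists f => //.
have [E0 _ E] := Ef.
apply: (gruns_seq (gruns_stepl _ _) (t2 := 3)) => //.
have <- : isblank (f (p * K)) = (p == 0).
  case: p pN => [|p] pN; first by rewrite E0.
  (* The cell to the left of block [p.+1] is the last cell of block [p], hence a bit and not the
     blank of cell [0]. *)
  have := E p K.-1 pN; rewrite prednK // => /(_ (leqnn K)).
  have -> : (p * K + K.-1).+1 = p.+1 * K by rewrite mulSnr; lia.
  by move=> ->; rewrite bit_blank.
by apply: (gruns_ret (gruns_test isblank f (p * K)) (gruns_stepr f (p * K))).
Qed.

Definition gohome := loopm athome (moves mleft K).

Lemma vruns_home v p : p <= N ->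
  gruns vrepr gohome (v, p) true (v, 0) (p * (K + 5) + 4).
Proof.
elim: p => [|p IH] pN; first by apply: gruns_loop_exit; apply: (vruns_athome v pN).
apply: (gruns_loop_next (vruns_athome v pN) (vruns_prev v p) (IH (ltnW pN))).
by rewrite mulSn; lia.
Qed.

Definition findm (a : mach) := loopm a (moves mright K).

Lemma vruns_find a v p k t : p + k < N ->
  (forall j, p <= j <= p + k -> gruns vrepr a (v, j) (j == p + k) (v, j) t) ->
  gruns vrepr (findm a) (v, p) true (v, p + k) (k.+1 * (t + K.+1)).
Proof.
elim: k p => [|k IH] p qN H.
  rewrite addn0 in H *; apply: (gruns_le (t := t)); first by lia.
  by apply: gruns_loop_exit; have := H p; rewrite eqxx; apply; lia.
apply: (gruns_loop_next (t3 := k.+1 * (t + K.+1)) _ (vruns_next v p)).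
- by have := H p; have -> : (p == p + k.+1) = false by [lia]; apply; lia.
- by rewrite -addSnnS; apply: IH => [|j Hj]; rewrite addSnnS //; apply: H; lia.
- by rewrite !mulSn; lia.
Qed.

End Blocks.

(** * A language of bounded loops *)

(* Registers hold block numbers; an array assigns a bit to every block. *)
Record state := State { reg : nat -> nat; arr : nat -> nat -> bool }.

Definition setr st r x :=
  State (fun r' => if r' == r then x else reg st r') (arr st).
Definition seta st a p b :=
  State (reg st) (fun a' p' => if (a' == a) && (p' == p) then b else arr st a' p').

(* [Test t r] looks up track [t] (an array, or the mark of a register) in the
   block that [r] points to.  [Loop r e] runs [e] with [r] increasing from its
   current value, until [e] succeeds or [r] reaches the last block. *)
Inductive exp :=
  | Ret of bool
  | Test of nat & nat
  | Lt of nat & nat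
  | Copy of nat & nat
  | Inc of nat
  | Put of nat & nat & bool
  | Ite of exp & exp & exp
  | Loop of nat & exp.

Section Language.
(* Tracks below [KR] are register marks, those from [KR] to [K] are arrays. *)
Variables (K KR : nat).

(** A register is stored as the indicator of its value, so that [Test] on a register mark decides
    whether two registers are equal. *)
Definition track st t p := if t < KR then reg st t == p else arr st t p.

(** The argument [k] is fuel. In [eval], [N] rounds suffice as long as the body leaves [r] alone,
    because [r] grows with every round and stays below [N]. *)
Fixpoint loopn N r (f : state -> bool * state) k st :=
  if k is k'.+1 then
    let: (b, st1) := f st in
    if b then (true, st1)
    else if (reg st1 r).+1 < N then loopn N r f k' (setr st1 r (reg st1 r).+1)
    else (false, st1)
  else (false, st).

Fixpoint eval N e st : bool * state :=
  match e with
  | Ret b => (b, st)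
  | Test t r => (track st t (reg st r), st)
  | Lt r r' => (reg st r < reg st r', st)
  | Copy r r' => (true, setr st r (reg st r'))
  | Inc r => if (reg st r).+1 < N then (true, setr st r (reg st r).+1)
             else (false, st)
  | Put a r b => (true, seta st a (reg st r) b)
  | Ite e1 e2 e3 => let: (b, st1) := eval N e1 st in
                    eval N (if b then e2 else e3) st1
  | Loop r e1 => loopn N r (eval N e1) N st
  end.

Fixpoint wreg e : seq nat :=
  match e with
  | Copy r _ | Inc r => [:: r]
  | Ite e1 e2 e3 => wreg e1 ++ wreg e2 ++ wreg e3
  | Loop r e1 => r :: wreg e1
  | _ => [::]
  end.

Fixpoint warr e : seq nat :=
  match e with
  | Put a _ _ => [:: a]
  | Ite e1 e2 e3 => warr e1 ++ warr e2 ++ warr e3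
  | Loop r e1 => warr e1
  | _ => [::]
  end.

(** [Copy r r'] first erases the mark of [r] and then searches for that of [r'], so the two must
    differ. The last condition on [Loop] is what makes the fuel of [loopn] sufficient. *)
Fixpoint wf e : bool :=
  match e with
  | Ret _ => true
  | Test t r => (t < K) && (r < KR)
  | Lt r r' => (r < KR) && (r' < KR)
  | Copy r r' => [&& r < KR, r' < KR & r != r']
  | Inc r => r < KR
  | Put a r _ => (KR <= a < K) && (r < KR)
  | Ite e1 e2 e3 => [&& wf e1, wf e2 & wf e3]
  | Loop r e1 => [&& wf e1, r < KR & r \notin wreg e1]
  end.

Lemma loopn_frame (P : state -> Prop) N r f k st :
  (forall s, P s -> P (f s).2) -> (forall s x, P s -> P (setr s r x)) ->
  P st -> P (loopn N r f k st).2.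
Proof.
move=> Hf Hr; elim: k st => //= k IH st Pst; have := Hf st Pst.
case: (f st) => -[] //= s1 Ps1; case: ifP => // _.
by apply/IH/Hr.
Qed.

Lemma eval_reg N e st r : r \notin wreg e -> reg (eval N e st).2 r = reg st r.
Proof.
elim: e st => //= [r1 r2|r1|e1 IH1 e2 IH2 e3 IH3|r1 e1 IH1] st.
- by rewrite inE => /negbTE->.
- by rewrite inE; case: ifP => //= _ /negbTE->.
- rewrite !mem_cat !negb_or => /and3P[N1 N2 N3].
  have := IH1 st N1; case: (eval N e1 st) => -[] /= s1 <-; [exact: IH2|exact: IH3].
rewrite inE negb_or => /andP[/negbTE N1 N2].
apply: (@loopn_frame (fun s => reg s r = reg st r)) => //= s; first by rewrite IH1.
by rewrite N1.
Qed.

Lemma eval_arr N e st a : a \notin warr e -> arr (eval N e st).2 a = arr st a.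
Proof.
elim: e st => //= [r1|a1 r1 b|e1 IH1 e2 IH2 e3 IH3|r1 e1 IH1] st.
- by case: ifP.
- rewrite inE => /negbTE-> /=.
  by apply: functional_extensionality.
- rewrite !mem_cat !negb_or => /and3P[N1 N2 N3].
  have := IH1 st N1; case: (eval N e1 st) => -[] /= s1 <-; [exact: IH2|exact: IH3].
by move=> N1; apply: (@loopn_frame (fun s => arr s a = arr st a)) => //= s; rewrite IH1.
Qed.

Definition regs_lt N st := forall r, r < KR -> reg st r < N.

Lemma eval_regs_lt N e st : wf e -> regs_lt N st -> regs_lt N (eval N e st).2.
Proof.
elim: e st => //= [r1 r2|r1|e1 IH1 e2 IH2 e3 IH3|r1 e1 IH1] st.
- by move=> /and3P[_ l2 _] ok r lr /=; case: ifP => // _; apply: ok.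
- move=> _ ok; case: ifP => //= lt r lr /=; case: ifP => // _; exact: ok.
- move=> /and3P[w1 w2 w3] ok; have := IH1 st w1 ok.
  by case: (eval N e1 st) => -[] /= s1 ok1; [apply: IH2|apply: IH3].
move=> /and3P[w1 l1 n1] ok.
suff H k s : regs_lt N s -> regs_lt N (loopn N r1 (eval N e1) k s).2 by exact: H.
elim: k s {st ok} => //= k IH st ok.
have := IH1 st w1 ok; case: (eval N e1 st) => -[] //= s1 ok1.
by case: ifP => // lt; apply: IH => r lr /=; case: ifP => // _; apply: ok1.
Qed.

(** * Compilation of the language *)

Definition c_test t r := seqm (findm K (rd r)) (retm (rd t) (gohome K)).
(** The search stops at the smaller of the two values; the comparison is strict exactly if the mark
    of [r'] is not in that block. *)
Definition c_lt r r' :=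
  seqm (findm K (ite (rd r) (idm true) (rd r')))
       (retm (ite (rd r') (idm false) (idm true)) (gohome K)).
Definition c_put a r b :=
  seqm (findm K (rd r)) (seqm (wr a (bit b)) (gohome K)).
Definition c_copy r r' := seqm (c_put r r false) (c_put r r' true).
(** The head looks one block ahead before anything is changed: in front of the closing blank the
    register stays where it is and the exit is [false], which is also how an exhausted loop ends. *)
Definition c_inc r :=
  seqm (findm K (rd r)) (seqm (moves mright K)
    (ite (testm isblank)
       (seqm (moves mleft K) (seqm (gohome K) (idm false)))
       (seqm (moves mleft K) (seqm (wr r (bit false)) (seqm (moves mright K)
          (seqm (wr r (bit true)) (gohome K))))))).

Fixpoint compile e : mach :=
  match e with
  | Ret b => idm b
  | Test t r => c_test t r
  | Lt r r' => c_lt r r'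
  | Copy r r' => c_copy r r'
  | Inc r => c_inc r
  | Put a r b => c_put a r b
  | Ite e1 e2 e3 => ite (compile e1) (compile e2) (compile e3)
  | Loop r e1 => loopm (compile e1) (c_inc r)
  end.

(** A common generous bound: every primitive makes a few sweeps over the [N] blocks, with a number
    of steps per block that is linear in [K]. *)
Definition prim_cost N := (20 * K + 60) * N.+1.

(** Both branches of [Ite] are charged, which keeps the bound independent of the state. *)
Fixpoint cost e N :=
  match e with
  | Ite e1 e2 e3 => cost e1 N + cost e2 N + cost e3 N
  | Loop _ e1 => N.+1 * (cost e1 N + prim_cost N)
  | _ => prim_cost N
  end.

Lemma cost_poly e : exists c k, forall N, cost e N <= c * N.+1 ^ k.
Proof.
have pc N : prim_cost N <= (20 * K + 60) * N.+1 ^ 1 by rewrite expn1.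
elim: e => /= [b|t r|r r'|r r'|r|a r b|e1 [c1 [k1 H1]] e2 [c2 [k2 H2]] e3 [c3 [k3 H3]]|r e1 [c1 [k1 H1]]];
  try by exists (20 * K + 60), 1.
(* The sum serves as a crude common upper bound of the three exponents. *)
- exists (c1 + c2 + c3), (k1 + k2 + k3) => N.
  have E k : k <= k1 + k2 + k3 -> N.+1 ^ k <= N.+1 ^ (k1 + k2 + k3) by apply: leq_pexp2l.
  rewrite !mulnDl !leq_add //.
  + by apply: leq_trans (H1 N) _; rewrite leq_mul2l E ?orbT //; lia.
  + by apply: leq_trans (H2 N) _; rewrite leq_mul2l E ?orbT //; lia.
  + by apply: leq_trans (H3 N) _; rewrite leq_mul2l E ?orbT //; lia.
exists (c1 + (20 * K + 60)), (k1 + 2) => N.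
have -> : (c1 + (20 * K + 60)) * N.+1 ^ (k1 + 2)
   = N.+1 * ((c1 + (20 * K + 60)) * N.+1 ^ (k1 + 1)).
  by rewrite addn1 addn2 [N.+1 ^ k1.+2]expnS mulnCA.
rewrite leq_mul2l /= mulnDl leq_add //.
  by apply: leq_trans (H1 N) _; rewrite leq_mul2l leq_pexp2l ?orbT //; lia.
by apply: leq_trans (pc N) _; rewrite leq_mul2l leq_pexp2l ?orbT //; lia.
Qed.

Section Correctness.
Hypotheses (KR0 : 0 < KR) (leKRK : KR <= K).
Variable N : nat.
Let K0 : 0 < K. Proof. by lia. Qed.
Let R := vrepr K N.

Lemma find_cost k c : k < N -> k.+1 * (c + K.+1) <= N * (c + K.+1).
Proof. by move=> kN; rewrite leq_mul2r kN orbT. Qed.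

Lemma home_cost k : k < N -> k * (K + 5) + 4 <= N * (K + 5) + 4.
Proof. by move=> kN; rewrite leq_add2r leq_mul2r ltnW ?orbT. Qed.

Lemma runs_find v r q : r < K -> q < N -> (forall p, p <= q -> v r p = (p == q)) ->
  gruns R (findm K (rd r)) (v, 0) true (v, q) (N * (3 * K + 6)).
Proof.
move=> rK qN Hv.
have H : gruns R (findm K (rd r)) (v, 0) true (v, 0 + q) (q.+1 * (2 * K + 5 + K.+1)).
  apply: vruns_find => // p /andP[_ lepq].
  by rewrite add0n -Hv //; apply: vruns_rd => //; lia.
by apply: gruns_le H; apply: leq_trans (find_cost _ qN) _; rewrite leq_mul2l; apply/orP; right; lia.
Qed.

Lemma runs_home v p : p < N -> gruns R (gohome K) (v, p) true (v, 0) (N * (K + 5) + 4).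
Proof. by move=> pN; apply: gruns_le (vruns_home _ v (ltnW pN)); rewrite ?home_cost. Qed.

Lemma runs_put v a r b q : r < K -> a < K -> q < N ->
  (forall p, p <= q -> v r p = (p == q)) ->
  gruns R (c_put a r b) (v, 0) true (updv v a q b, 0)
    (N * (4 * K + 11) + 2 * K + 9).
Proof.
move=> rK aK qN Hv; apply: (gruns_seq (runs_find rK qN Hv)).
  by apply: (gruns_seq (vruns_wr b v qN aK) (runs_home _ qN) (leqnn _)).
by lia.
Qed.

Lemma track_setr st r x : r < KR ->
  updv (updv (track st) r (reg st r) false) r x true = track (setr st r x).
Proof.
move=> rK; apply: functional_extensionality => t; apply: functional_extensionality => p.
rewrite /updv /track /=; case: (eqVneq t r) => [->|] //=.
by rewrite rK eq_sym; case: (eqVneq x p) => //= ne; case: eqVneq => // ->; rewrite eqxx.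
Qed.

Lemma track_seta st a p b : KR <= a -> updv (track st) a p b = track (seta st a p b).
Proof.
move=> aK; apply: functional_extensionality => t; apply: functional_extensionality => q.
rewrite /updv /track /=; case: ltnP => // tK.
by case: eqVneq => // E; move: tK; rewrite E ltnNge aK.
Qed.

Lemma track_reg st r : r < KR -> forall p, track st r p = (p == reg st r).
Proof. by move=> rK p; rewrite /track rK eq_sym. Qed.

Lemma runs_inc st r : r < KR -> regs_lt N st ->
  gruns R (c_inc r) (track st, 0) (eval N (Inc r) st).1
    (track (eval N (Inc r) st).2, 0) (prim_cost N).
Proof.
move=> rK ok; have qN := ok r rK; have rK' : r < K by lia.
have F := runs_find (v := track st) rK' qN (fun p _ => track_reg st rK p).
apply: (gruns_seq F (t2 := N * (K + 5) + 20 + 7 * K)); last first.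
  by rewrite /prim_cost; lia.
apply: (gruns_seq (vruns_next _ _ _ _) (t2 := N * (K + 5) + 19 + 6 * K)); last by lia.
apply: (gruns_ite (vruns_end _ (track st) qN) (t2 := N * (K + 5) + 18 + 6 * K)) => //; last by lia.
rewrite /=; case: eqVneq => [E|ne]; [have -> /= : ((reg st r).+1 < N) = false by [lia]|have lt : (reg st r).+1 < N by lia]; last rewrite lt /=.
  apply: (gruns_seq (vruns_prev _ _ _ _) (t2 := N * (K + 5) + 5)); last by lia.
  by apply: (gruns_seq (runs_home _ (ok r rK)) (gruns_id _ _ _)); lia.
apply: (gruns_seq (vruns_prev _ _ _ _) (t2 := N * (K + 5) + 17 + 5 * K)); last by lia.
apply: (gruns_seq (vruns_wr false _ (ok r rK) rK') (t2 := N * (K + 5) + 12 + 3 * K)); last by lia.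
apply: (gruns_seq (vruns_next _ _ _ _) (t2 := N * (K + 5) + 11 + 2 * K)); last by lia.
apply: (gruns_seq (vruns_wr true _ lt rK') (t2 := N * (K + 5) + 4)); last by lia.
by rewrite track_setr //; apply: runs_home.
Qed.

Lemma compile_correct e st : wf e -> regs_lt N st ->
  gruns R (compile e) (track st, 0) (eval N e st).1 (track (eval N e st).2, 0)
    (cost e N).
Proof.
elim: e st => [b|t r|r r'|r r'|r|a r b|e1 IH1 e2 IH2 e3 IH3|r e1 IH1] st.
- by move=> _ _; apply: (gruns_le _ (gruns_id _ _ _)); rewrite /= /prim_cost; lia.
- move=> /= /andP[tK rK] ok; have qN := ok r rK; have rK' : r < K by lia.
  have F := runs_find (v := track st) rK' qN (fun p _ => track_reg st rK p).
  apply: (gruns_seq F); first by apply: (gruns_ret (vruns_rd (track st) qN tK) (runs_home _ qN) (leqnn _)).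
  by rewrite /prim_cost; lia.
- move=> /= /andP[rK rK'] ok.
  pose q := minn (reg st r) (reg st r').
  have qN : q < N by have := ok r rK; rewrite /q; lia.
  have F : gruns R (findm K (ite (rd r) (idm true) (rd r'))) (track st, 0) true
             (track st, 0 + q) (q.+1 * (4 * K + 10 + K.+1)).
    apply: vruns_find => // p /andP[_ lepq]; have pN : p < N by lia.
    have pr := vruns_rd (track st) pN (leq_trans rK leKRK).
    have pr' := vruns_rd (track st) pN (leq_trans rK' leKRK).
    rewrite !track_reg // in pr pr'.
    have -> : (p == 0 + q) = (p == reg st r) || (p == reg st r') by rewrite /q in lepq *; lia.
    apply: (gruns_ite (t2 := 2 * K + 5) pr); last by lia.
    by case: (p == reg st r) => //=; apply: (gruns_le _ (gruns_id _ _ _)); lia.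
  apply: (gruns_seq (gruns_le (find_cost _ qN) F) (t2 := N * (K + 5) + 2 * K + 20)); last first.
    by rewrite /prim_cost; lia.
  have G : gruns R (ite (rd r') (idm false) (idm true)) (track st, q)
             (reg st r < reg st r') (track st, q) (2 * K + 6).
    have pr' := vruns_rd (track st) qN (leq_trans rK' leKRK).
    apply: (gruns_ite (t2 := 1) pr'); last by lia.
    rewrite track_reg //; have -> : (q == reg st r') = ~~ (reg st r < reg st r') by rewrite /q; lia.
    by case: (_ < _); apply: gruns_id.
  by apply: (gruns_ret G (runs_home _ qN)); lia.
- move=> /= /and3P[rK rK' ne] ok.
  have qN := ok r rK; have qN' := ok r' rK'.
  have lr : r < K by lia. have lr' : r' < K by lia.
  have P1 := runs_put false lr lr qN (fun p _ => track_reg st rK p).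
  have H2 p : p <= reg st r' -> updv (track st) r (reg st r) false r' p = (p == reg st r').
    by move=> _; rewrite /updv eq_sym (negbTE ne) /= track_reg.
  have P2 := runs_put true lr' lr qN' H2.
  rewrite track_setr // in P2; apply: (gruns_seq P1 P2).
  by rewrite /prim_cost; lia.
- exact: runs_inc.
- move=> /= /andP[/andP[aK aK'] rK] ok; have qN := ok r rK; have rK' : r < K by lia.
  have P1 := runs_put b rK' aK' qN (fun p _ => track_reg st rK p).
  rewrite track_seta // in P1; apply: gruns_le P1.
  by rewrite /prim_cost; lia.
- move=> /= /and3P[w1 w2 w3] ok.
  have := IH1 st w1 ok; have := eval_regs_lt w1 ok.
  case: (eval N e1 st) => b s1 /= ok1 G1.
  apply: (gruns_ite (t2 := cost e2 N + cost e3 N) G1); last by lia.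
  by case: b {G1}; [apply: gruns_le (IH2 _ w2 ok1)|apply: gruns_le (IH3 _ w3 ok1)]; lia.
move=> /= /and3P[w1 rK nw] ok.
(* Generalised over the fuel, which has to cover the distance that the loop register can still
   travel. *)
suff H k s : regs_lt N s -> N - reg s r <= k ->
   gruns R (loopm (compile e1) (c_inc r)) (track s, 0)
     (loopn N r (eval N e1) k s).1 (track (loopn N r (eval N e1) k s).2, 0)
     (k.+1 * (cost e1 N + prim_cost N)).
  by apply: H => //; apply: leq_subr.
elim: k s => [|k IH] s oks lek; first by have := oks r rK; lia.
have := IH1 s w1 oks; have := eval_regs_lt w1 oks; have := eval_reg N s nw.
rewrite /=; case: (eval N e1 s) => -[] s1 /= E1 ok1 G1.
  by apply: gruns_le (gruns_loop_exit _ G1); lia.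
have := runs_inc rK ok1; rewrite /=; case: ifP => /= lt I1; last first.
  by apply: (gruns_loop_fail G1 I1); lia.
apply: (gruns_loop_next G1 I1 (t3 := k.+1 * (cost e1 N + prim_cost N))); last first.
  by lia.
apply: IH; last by rewrite /= eqxx E1; move: lek; lia.
by move=> r1 lr1 /=; case: ifP => // _; apply: ok1.
Qed.

End Correctness.
End Language.

(** * Loading the input *)

(** With predicates on tapes as abstract states, the representation may change in the middle of a
    run: loading starts from raw cells and ends with blocks. *)
Definition gruns_to (m : mach) (P : tape -> Prop) b (Q : tape -> Prop) t :=
  gruns (fun P : tape -> Prop => P) m P b Q t.

Lemma gruns_toP X (R : X -> tape -> Prop) m x b y t :
  gruns R m x b y t -> gruns_to m (R x) b (R y) t.
Proof. by case=> H; split. Qed.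

Fixpoint wblock (g : nat -> bool) k :=
  if k is k'.+1 then seqm (putm (bit (g k')) mleft) (wblock g k') else idm true.

Lemma gruns_wblock g k f i :
  gruns trepr (wblock g k) (f, i + k) true
    (fun j => if i < j <= i + k then bit (g (j - i.+1)) else f j, i) k.+1.
Proof.
elim: k f => [|k IH] f /=.
  rewrite addn0; have -> : (fun j => if i < j <= i then bit (g (j - i.+1)) else f j) = f.
    by apply: functional_extensionality => j; case: ifP => //; lia.
  exact: gruns_id.
rewrite addnS; apply: (gruns_seq (gruns_putl _ f (i + k)) (t2 := k.+1)) => //.
have := IH (upd f (i + k).+1 (bit (g k))).
suff -> : (fun j => if i < j <= i + k then bit (g (j - i.+1))
                    else upd f (i + k).+1 (bit (g k)) j)
   = (fun j => if i < j <= (i + k).+1 then bit (g (j - i.+1)) else f j) by [].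
apply: functional_extensionality => j; rewrite /upd.
case: (eqVneq j (i + k).+1) => [->|ne].
  have -> : (i < (i + k).+1 <= i + k) = false by lia.
  have -> : (i < (i + k).+1 <= (i + k).+1) = true by lia.
  by congr (bit (g _)); lia.
by have -> : (i < j <= (i + k).+1) = (i < j <= i + k) by lia.
Qed.

Section Load.
Variables (K KR : nat) (blk : 'I_4 -> nat -> bool).
Hypotheses (KR0 : 0 < KR) (leKRK : KR <= K).
Hypothesis blk_reg : forall c t, t < KR -> blk c t = false.

(** The symbol under way is remembered in the control state, so there is one copy of this machine
    for each non-blank symbol. The blank between blocks and input stops the scans in both
    directions; a second blank right after it means that no input is left. *)
Definition move_symbol c :=
  seqm (putm sym_blank mleft) (seqm (scan mleft) (seqm (step1 mleft)
  (seqm (scan mleft) (seqm (wblock (blk c) K) (seqm (step1 mright)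
  (seqm (scan mright) (seqm (step1 mright)
  (ite (testm isblank) (idm false)
     (seqm (scan mright) (step1 mleft)))))))))).

Definition load_round :=
  ite (testm (pred1 sym_1)) (move_symbol sym_1)
    (ite (testm (pred1 sym_sep)) (move_symbol sym_sep) (move_symbol sym_0)).

Fixpoint marks k := if k is k'.+1 then seqm (marks k') (wr k' (bit true)) else idm true.

(* The input is erased from right to left, each symbol becoming a block to the
   left of the previous ones, so that the blocks end up in the original order. *)
Definition load :=
  seqm (scan mright) (seqm (step1 mleft) (seqm (loopm (idm false) load_round)
    (seqm (moves mleft 2) (seqm (scan mleft) (seqm (step1 mright) (marks KR)))))).

Variable w : seq 'I_4.
Hypotheses (w_nonblank : sym_blank \notin w) (w_nonempty : 0 < size w).
Let N := size w.
(** Cells are numbered so that the input starts at [off]: the blocks will fill cells [1] to [N * K],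
    delimited by blanks in cells [0] and [(N * K).+1]. *)
Let off := (N * K).+2.

(* The tape when [k] input symbols are still to be moved. *)
Definition load_tape k j :=
  if off <= j then (if j - off < k then nth sym_blank w (j - off) else sym_blank)
  else if k * K < j <= N * K
       then bit (blk (nth sym_blank w (j.-1 %/ K)) (j.-1 %% K))
       else sym_blank.

Let nthw j : j < N -> nth sym_blank w j != sym_blank.
Proof. by move=> jN; apply: contra w_nonblank => /eqP <-; apply: mem_nth. Qed.

Lemma bitN b : bit b != sym_blank. Proof. by case: b. Qed.

Lemma load_tape_in k j : k <= N -> off <= j < off + k -> load_tape k j != sym_blank.
Proof.
by move=> kN /andP[l1 l2]; rewrite /load_tape l1 ifT ?nthw //; lia.
Qed.

Lemma load_tape_out k j : k * K < j <= N * K -> load_tape k j != sym_blank.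
Proof.
move=> Hj; rewrite /load_tape ifN; last by rewrite /off; lia.
by rewrite Hj bitN.
Qed.

Lemma load_tape_b k j : j <= k * K -> j < off -> load_tape k j = sym_blank.
Proof. by move=> l1 l2; rewrite /load_tape ifN ?ifN //; lia. Qed.

Lemma load_tape_sep k : load_tape k off.-1 = sym_blank.
Proof. by rewrite /load_tape /off ifN ?ifN //; lia. Qed.

Lemma load_tape_end k : load_tape k (off + k) = sym_blank.
Proof. by rewrite /load_tape leq_addr addKn ltnn. Qed.

(** A round crosses the remaining input twice and the room of the blocks at most twice, at three
    steps per cell, and writes [K] cells; the rest is slack. *)
Definition round_cost := 12 * (N * K + N) + K + 40.

Lemma load_tape_step k : k < N ->
  (fun j => if k * K < j <= k * K + K then
              bit (blk (nth sym_blank w k) (j - (k * K).+1))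
            else upd (load_tape k.+1) (off + k) sym_blank j) = load_tape k.
Proof.
move=> kN; have kK : k.+1 * K <= N * K by rewrite leq_mul2r kN orbT.
rewrite mulSn in kK.
apply: functional_extensionality => j; rewrite /upd /load_tape mulSn.
case: ifP => Hj.
  rewrite ifN; last by rewrite /off; lia.
  rewrite ifT; last by lia.
  have -> : j.-1 = k * K + (j - (k * K).+1) by lia.
  rewrite divnMDl ?modnMDl; last by lia.
  by rewrite divn_small ?modn_small ?addn0 //; lia.
case: eqP => [->|ne]; first by rewrite leq_addr addKn ltnn.
case: ifP => lo; first by have -> : (j - off < k.+1) = (j - off < k) by lia.
by have -> : (K + k * K < j <= N * K) = (k * K < j <= N * K) by lia.
Qed.

Lemma gruns_move k : k < N ->
  gruns trepr (move_symbol (nth sym_blank w k)) (load_tape k.+1, off + k) (k != 0)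
    (load_tape k, if k == 0 then off else off + k.-1) (round_cost - 5).
Proof.
move=> kN; have kK : k.+1 * K <= N * K by rewrite leq_mul2r kN orbT.
rewrite mulSn in kK.
set f1 := upd (load_tape k.+1) (off + k) sym_blank.
have f1E j : j != off + k -> f1 j = load_tape k.+1 j by rewrite /f1 /upd => /negbTE->.
have E1 : off + k = (off.-1 + k).+1 by rewrite /off; lia.
have S1 : gruns trepr (putm sym_blank mleft) (load_tape k.+1, off + k) true (f1, off.-1 + k) 1.
  by rewrite /f1 E1; apply: gruns_putl.
apply: (gruns_seq S1 (t2 := round_cost - 6)); last by rewrite /round_cost; lia.
have S2 : gruns trepr (scan mleft) (f1, off.-1 + k) true (f1, off.-1) (3 * k).+1.
  apply: gruns_scanl => [j Hj|]; rewrite f1E ?load_tape_sep //; rewrite /off in E1 *; try lia.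
  by apply: load_tape_in => //; rewrite /off; lia.
apply: (gruns_seq S2 (t2 := round_cost - (7 + 3 * k))); last by rewrite /round_cost; lia.
apply: (gruns_seq (gruns_stepl f1 (N * K)) (t2 := round_cost - (8 + 3 * k))); last by rewrite /round_cost; lia.
have S3 : gruns trepr (scan mleft) (f1, N * K) true (f1, k * K + K) (3 * (N * K)).+1.
  have -> : N * K = k * K + K + (N * K - (k * K + K)) by lia.
  apply: gruns_le (gruns_scanl _ _); first by lia.
    move=> j Hj; rewrite f1E; last by rewrite /off; lia.
    by apply: load_tape_out; rewrite mulSn; lia.
  rewrite f1E; last by rewrite /off; lia.
  by apply: load_tape_b; rewrite ?mulSn /off; lia.
apply: (gruns_seq S3 (t2 := round_cost - (9 + 3 * k + 3 * (N * K)))); last by rewrite /round_cost; lia.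
have S4 := gruns_wblock (blk (nth sym_blank w k)) K f1 (k * K).
rewrite load_tape_step // in S4.
apply: (gruns_seq S4 (t2 := round_cost - (10 + K + 3 * k + 3 * (N * K)))); last by rewrite /round_cost; lia.
apply: (gruns_seq (gruns_stepr _ _) (t2 := round_cost - (11 + K + 3 * k + 3 * (N * K)))); last by rewrite /round_cost; lia.
have S5 : gruns trepr (scan mright) (load_tape k, (k * K).+1) true (load_tape k, off.-1) (3 * (N * K)).+1.
  have E5 : off.-1 = (k * K).+1 + (N * K - k * K) by rewrite /off; lia.
  rewrite E5; apply: gruns_le (gruns_scanr _ _); first by lia.
    by move=> j Hj; apply: load_tape_out; lia.
  by rewrite -E5 load_tape_sep.
apply: (gruns_seq S5 (t2 := round_cost - (12 + K + 3 * k + 6 * (N * K)))); last by rewrite /round_cost; lia.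
apply: (gruns_seq (gruns_stepr _ _) (t2 := round_cost - (13 + K + 3 * k + 6 * (N * K)))); last by rewrite /round_cost; lia.
apply: (gruns_ite (gruns_test isblank _ _) (t2 := round_cost - (14 + K + 3 * k + 6 * (N * K)))); last by rewrite /round_cost; lia.
rewrite -[off.-1.+1]/off; case: (posnP k) => [->|k0].
  have := load_tape_end 0; rewrite addn0 => ->; rewrite /isblank /=.
  by apply: gruns_le (gruns_id _ _ _); rewrite /round_cost; lia.
have -> : isblank (load_tape k off) = false.
  by apply/negbTE/load_tape_in => //; [exact: ltnW|lia].
have S6 : gruns trepr (scan mright) (load_tape k, off) true (load_tape k, off + k) (3 * k).+1.
  apply: gruns_scanr => [j Hj|]; last exact: load_tape_end.
  by apply: load_tape_in => //; exact: ltnW.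
rewrite /=; have E6 : off + k = (off + k.-1).+1 by lia.
rewrite E6 in S6.
by apply: (gruns_seq S6 (gruns_stepl _ _)); rewrite /round_cost; lia.
Qed.

Lemma gruns_round k : k < N ->
  gruns trepr load_round (load_tape k.+1, off + k) (k != 0)
    (load_tape k, if k == 0 then off else off + k.-1) round_cost.
Proof.
move=> kN; have M := gruns_move kN; have nb := nthw kN.
have E : load_tape k.+1 (off + k) = nth sym_blank w k.
  by rewrite /load_tape leq_addr addKn ltnSn.
have T P := gruns_test P (load_tape k.+1) (off + k).
rewrite E in T.
apply: (gruns_ite (T _) (t2 := round_cost - 4)); last by rewrite /round_cost; lia.
rewrite [pred1 _ _]/=; case: (nth sym_blank w k =P sym_1) => [E1|ne1].
  by rewrite E1 in M; apply: gruns_le M; rewrite /round_cost; lia.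
apply: (gruns_ite (T _) (t2 := round_cost - 5)); last by rewrite /round_cost; lia.
rewrite [pred1 _ _]/=; case: (nth sym_blank w k =P sym_sep) => [E2|ne2].
  by rewrite E2 in M.
suff E0 : nth sym_blank w k = sym_0 by rewrite E0 in M.
move: nb ne1 ne2; move: (nth sym_blank w k) => c /eqP nb ne1 ne2.
have v0 : c <> 0 :> nat by move=> E0; apply: nb; apply: val_inj.
have v2 : c <> 2 :> nat by move=> E0; apply: ne1; apply: val_inj.
have v3 : c <> 3 :> nat by move=> E0; apply: ne2; apply: val_inj.
by apply: val_inj; have := ltn_ord c; rewrite /=; lia.
Qed.

(** The loop cannot end by success of [idm false]; it ends when a round fails, that is, when the
    input is used up. *)
Lemma gruns_load_loop k : k < N ->
  gruns trepr (loopm (idm false) load_round) (load_tape k.+1, off + k) false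
    (load_tape 0, off) (k.+1 * (round_cost + 1)).
Proof.
elim: k => [|k IH] kN.
  by apply: (gruns_loop_fail (gruns_id _ _ _) (gruns_round kN)); lia.
apply: (gruns_loop_next (gruns_id _ _ _) (gruns_round kN) (IH (ltnW kN))).
by lia.
Qed.

Definition init_state : state :=
  State (fun _ => 0) (fun t p => blk (nth sym_blank w p) t).

Lemma vruns_marks k : k <= KR ->
  gruns (vrepr K N) (marks k) (fun t p => blk (nth sym_blank w p) t, 0) true
    (fun t p => if t < k then p == 0 else blk (nth sym_blank w p) t, 0)
    (k * (2 * K + 5) + 1).
Proof.
elim: k => [|k IH] kK /=; first exact: gruns_id.
have kK' : k < K by lia.
have W := vruns_wr true (fun t p => if t < k then p == 0 else blk (nth sym_blank w p) t)
   w_nonempty kK'.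
apply: (gruns_seq (IH (ltnW kK)) (t2 := 2 * K + 5)); last by lia.
suff E : updv (fun t p => if t < k then p == 0 else blk (nth sym_blank w p) t) k 0 true
   = (fun t p => if t < k.+1 then p == 0 else blk (nth sym_blank w p) t) by rewrite -E.
apply: functional_extensionality => t; apply: functional_extensionality => p.
rewrite /updv; case: (ltngtP t k) => [lt|gt|->] /=.
- by rewrite ltnS (ltnW lt).
- by rewrite ltnS leqNgt gt.
by rewrite ltnSn; case: eqP => // _; apply: blk_reg.
Qed.

Lemma encv_load_tape : encv K N (fun t p => blk (nth sym_blank w p) t) (load_tape 0).
Proof.
split=> [||p t pN tK].
- exact: load_tape_b.
- exact: load_tape_sep.
have pK : p.+1 * K <= N * K by rewrite leq_mul2r pN orbT.
rewrite mulSn in pK; rewrite /load_tape ifN; last by rewrite /off; lia.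
rewrite ifT; last by lia.
by rewrite /= divnMDl ?modnMDl ?divn_small ?modn_small ?addn0 //; lia.
Qed.

(** Quadratic in the length of [w], since each symbol travels past all blocks written so far. *)
Definition load_cost := 20 * (K + 1) ^ 2 * N.+1 ^ 2 + 200 * (K + 1) ^ 2 * N.+1.

Lemma load_correct :
  gruns_to load (fun tp => tp = ([::], head sym_blank w, behead w)) true
    (vrepr K N (track KR init_state, 0)) load_cost.
Proof.
have H0 : gruns_to load (trepr (load_tape N, off)) true
    (vrepr K N (track KR init_state, 0)) load_cost.
  have S1 : gruns trepr (scan mright) (load_tape N, off) true (load_tape N, off + N) (3 * N).+1.
    by apply: gruns_scanr => [j Hj|]; [apply: load_tape_in|apply: load_tape_end].
  apply: (gruns_seq (gruns_toP S1)
     (t2 := 10 + (N * (round_cost + 1) + 4 * (N * K) + K * (2 * K + 5)))).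
    have S2 := gruns_stepl (load_tape N) (off + N.-1).
    rewrite -addnS prednK // in S2.
    apply: (gruns_seq (gruns_toP S2)
       (t2 := 9 + (N * (round_cost + 1) + 4 * (N * K) + K * (2 * K + 5)))); last by lia.
    have kN : N.-1 < N by rewrite prednK.
    have S3 := gruns_load_loop kN; rewrite prednK // in S3.
    apply: (gruns_seq (gruns_toP S3) (t2 := 9 + (4 * (N * K) + K * (2 * K + 5)))); last by lia.
    have S4 : gruns trepr (moves mleft 2) (load_tape 0, off) true (load_tape 0, N * K) 3.
      by have := gruns_movl 2 (load_tape 0) (N * K); rewrite [N * K + 2]addn2.
    apply: (gruns_seq (gruns_toP S4) (t2 := 6 + (4 * (N * K) + K * (2 * K + 5)))); last by lia.
    have S5 : gruns trepr (scan mleft) (load_tape 0, N * K) true (load_tape 0, 0) (3 * (N * K)).+1.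
      rewrite -{1}[N * K]add0n; apply: gruns_scanl => [j Hj|]; last exact: load_tape_b.
      by apply: load_tape_out; lia.
    apply: (gruns_seq (gruns_toP S5) (t2 := 2 + K * (2 * K + 5))); last by lia.
    apply: (gruns_seq (gruns_toP (gruns_stepr _ _)) (t2 := 1 + K * (2 * K + 5))); last by lia.
    have M := gruns_toP (vruns_marks (leqnn KR)).
    have E : track KR init_state
       = (fun t p => if t < KR then p == 0 else blk (nth sym_blank w p) t).
      apply: functional_extensionality => t; apply: functional_extensionality => p.
      by rewrite /track /= eq_sym.
    rewrite E; split=> tp Htp.
    have [|tp' H' [k lek Ek]] := grunsP M (tp := tp).
      by exists (load_tape 0); [exact: encv_load_tape|].
    exists tp' => //; exists k => //; apply: leq_trans lek _.
    by rewrite addnC leq_add2l leq_mul2r leKRK orbT.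
  rewrite /load_cost /round_cost; move: leKRK KR0 w_nonempty; rewrite -/N; clear; nia.
split=> tp ->; apply: (grunsP H0); split=> [|k lek|k].
- by rewrite /load_tape leqnn subnn w_nonempty nth0.
- rewrite nth_nil /load_tape ifN; last by lia.
  by rewrite ifN //; lia.
rewrite nth_behead /load_tape ifT; last by lia.
have -> : off.+1 + k - off = k.+1 by lia.
by case: ifP => // /negbT; rewrite -leqNgt => ?; rewrite nth_default.
Qed.

End Load.

(** * Derived loops and their invariants *)

Definition Seq a b := Ite a b b.
Definition When a b := Ite a b (Ret true).
Definition And a b := Ite a b (Ret false).
(* Register 0 is never written and holds 0. *)
Definition Exists r e := Seq (Copy r 0) (Loop r e).
Definition For r e := Exists r (Seq e (Ret false)).
Definition Rep r m e := For r (When (Lt r m) e).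

Section Derived.
Variables (KR N : nat).
Hypothesis N0 : 0 < N.
Let ev := eval KR N.

Definition same_but r (rs ars : seq nat) st s :=
  (forall r', r' \notin r :: rs -> reg s r' = reg st r') /\
  (forall a, a \notin ars -> arr s a = arr st a).

Lemma eval_Seq a b st : ev (Seq a b) st = ev b (ev a st).2.
Proof. by rewrite /ev /=; case: (eval KR N a st) => -[]. Qed.

Lemma eval_When a b st : (ev (When a b) st).2 =
  if (ev a st).1 then (ev b (ev a st).2).2 else (ev a st).2.
Proof. by rewrite /ev /=; case: (eval KR N a st) => -[]. Qed.

(** The invariant is carried through failing rounds only, since a success ends the loop. It must
    survive assignments to [r] because the loop itself moves [r] between rounds. *)
Lemma exists_spec r e st (phi : pred nat) (Inv : nat -> state -> Prop) :
  r \notin wreg e -> reg st 0 = 0 ->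
  (forall x s y, Inv x s -> Inv x (setr s r y)) -> Inv 0 st ->
  (forall x s, x < N -> reg s r = x -> same_but r (wreg e) (warr e) st s ->
     Inv x s -> (ev e s).1 = phi x /\ (~~ phi x -> Inv x.+1 (ev e s).2)) ->
  (ev (Exists r e) st).1 = has phi (iota 0 N) /\
  (~~ has phi (iota 0 N) -> Inv N (ev (Exists r e) st).2).
Proof.
move=> nr z0 Ir I0 step.
have -> : ev (Exists r e) st = loopn N r (ev e) N (setr st r 0) by rewrite /ev /= z0.
suff H k x s : x + k.+1 = N -> reg s r = x -> same_but r (wreg e) (warr e) st s ->
    Inv x s -> (loopn N r (ev e) k.+1 s).1 = has phi (iota x k.+1) /\
    (~~ has phi (iota x k.+1) -> Inv N (loopn N r (ev e) k.+1 s).2).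
  have := H N.-1 0 (setr st r 0); rewrite prednK // => /(_ erefl); apply=> /=.
  - by rewrite eqxx.
  - by split=> //= r'; rewrite inE negb_or => /andP[/negbTE->].
  - exact: Ir.
elim: k x s => [|k IH] x s Ex rx fr Ix.
  have xN : x < N by lia.
  have := step x s xN rx fr Ix; have := eval_reg KR N s nr.
  rewrite /ev /=; case: (eval KR N e s) => -[] s1 /= E1 [<- H2] //=.
  by rewrite E1 rx; have -> : (x.+1 < N) = false by [lia]; split=> // /H2; have -> : x.+1 = N by [lia].
have xN : x < N by lia.
have := step x s xN rx fr Ix; have := eval_reg KR N s nr.
have FR r' : r' \notin wreg e -> reg (eval KR N e s).2 r' = reg s r' by exact: eval_reg.
have FA a : a \notin warr e -> arr (eval KR N e s).2 a = arr s a by exact: eval_arr.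
have -> : loopn N r (ev e) k.+2 s = let: (b, st1) := ev e s in
    if b then (true, st1)
    else if (reg st1 r).+1 < N then loopn N r (ev e) k.+1 (setr st1 r (reg st1 r).+1)
    else (false, st1) by [].
have -> : iota x k.+2 = x :: iota x.+1 k.+1 by [].
move: (IH x.+1) FR FA; move: (iota x.+1 k.+1) (loopn N r (ev e) k.+1) => J L {}IH.
rewrite -/(ev e s); case: (ev e s) => -[] s1 /= FR FA E1 [<- H2] //=.
rewrite E1 rx; have -> : x.+1 < N by lia.
apply: IH => //=; [lia|by rewrite eqxx| |by apply/Ir/H2].
case: fr => fr1 fr2; split=> [r'|a] /=.
  by rewrite inE negb_or => /andP[/negbTE H3 H4]; rewrite H3 FR ?fr1 // inE negb_or H3.
by move=> Ha; rewrite FA // fr2.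
Qed.

Lemma for_spec r e st (Inv : nat -> state -> Prop) :
  r \notin wreg e -> reg st 0 = 0 ->
  (forall x s y, Inv x s -> Inv x (setr s r y)) -> Inv 0 st ->
  (forall x s, x < N -> reg s r = x -> same_but r (wreg e) (warr e) st s ->
     Inv x s -> Inv x.+1 (ev e s).2) ->
  Inv N (ev (For r e) st).2.
Proof.
move=> nr z0 Ir I0 step.
have wE : wreg (Seq e (Ret false)) = wreg e by rewrite /= cats0.
have aE : warr (Seq e (Ret false)) = warr e by rewrite /= cats0.
have [||||x s xN rx fr Ix|_] := @exists_spec r (Seq e (Ret false)) st pred0 Inv => //.
- by rewrite wE.
- rewrite eval_Seq /ev /=; split=> // _.
  by apply: (step x) => //; rewrite wE aE in fr.
by apply; rewrite has_pred0.
Qed.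

Lemma rep_spec r m e st (Inv : nat -> state -> Prop) :
  r \notin wreg e -> m \notin r :: wreg e -> reg st 0 = 0 -> reg st m < N ->
  (forall x s y, Inv x s -> Inv x (setr s r y)) -> Inv 0 st ->
  (forall x s, x < reg st m -> reg s r = x -> same_but r (wreg e) (warr e) st s ->
     Inv x s -> Inv x.+1 (ev e s).2) ->
  Inv (reg st m) (ev (Rep r m e) st).2.
Proof.
move=> nr nm z0 mN Ir I0 step.
have wE : wreg (When (Lt r m) e) = wreg e by rewrite /= cats0.
have aE : warr (When (Lt r m) e) = warr e by rewrite /= cats0.
rewrite -(minn_idPr (ltnW mN)).
(* Rounds beyond [reg st m] do nothing, so the invariant is frozen at that index. *)
apply: (@for_spec r (When (Lt r m) e) st (fun x s => Inv (minn x (reg st m)) s)) => //.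
- by rewrite wE.
- by move=> x s y; apply: Ir.
- by rewrite min0n.
move=> x s xN rx fr; rewrite wE aE in fr.
have Em : reg s m = reg st m by apply: fr.1.
rewrite eval_When /ev /= rx Em; case: ltnP => lt.
  by rewrite (minn_idPl lt); apply: step.
by rewrite (minn_idPr (leqW lt)).
Qed.

End Derived.

(** * Formulas and commands over vertices *)

(* Track numbers: 14 register marks, then the arrays. *)
Notation nregs := 14.
Notation ntracks := 19.
Notation aIN := 14.
Notation aSEP := 15.
Notation aRS := 16.
Notation aT := 17.
Notation aVIS := 18.

(* Registers 1 and 2 are scratch; the vertex bound at depth [l] is kept in
   register [vr l], vertex [v] being represented by block [v * n], where row [v]
   of a matrix starts.  The array [aRS] marks these blocks. *)
Definition vr l := 9 + l.

(** If [x] and [y] hold [i * n] and [j * n], exactly [j] row starts lie before the block of [y];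
    counting them from [i * n] on leaves the address [i * n + j] in register 1, without any
    multiplication. *)
Definition acc x y :=
  Seq (Copy 1 x) (For 2 (When (And (Test aRS 2) (Lt 2 y)) (Inc 1))).

(** First-order formulas over the vertices, with variables as de Bruijn levels and binary relations
    stored as matrices in arrays. *)
Inductive fm :=
  | FRel of nat & nat & nat
  | FEq of nat & nat
  | FAnd of fm & fm
  | FNot of fm
  | FEx of fm.

Inductive cm :=
  | CAsg of nat & nat & nat & fm
  | CSeq of cm & cm
  | CFor of cm.

Fixpoint fclosed d f :=
  match f with
  | FRel A x y => [&& nregs <= A, x < d & y < d]
  | FEq x y => [&& vr x < nregs, x < d & y < d]
  | FAnd f g => fclosed d f && fclosed d g
  | FNot f => fclosed d f
  | FEx f => fclosed d.+1 f
  end.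

Fixpoint cclosed d c :=
  match c with
  | CAsg A x y f => [&& nregs <= A, x < d, y < d, A != aRS & fclosed d f]
  | CSeq c1 c2 => cclosed d c1 && cclosed d c2
  | CFor c => cclosed d.+1 c
  end.

Fixpoint fcomp d f :=
  match f with
  | FRel A x y => Seq (acc (vr x) (vr y)) (Test A 1)
  | FEq x y => Test (vr x) (vr y)
  | FAnd f g => And (fcomp d f) (fcomp d g)
  | FNot f => Ite (fcomp d f) (Ret false) (Ret true)
  | FEx f => Exists (vr d) (And (Test aRS (vr d)) (fcomp d.+1 f))
  end.

Fixpoint ccomp d c :=
  match c with
  | CAsg A x y f =>
      let asg b := Seq (acc (vr x) (vr y)) (Put A 1 b) in
      Ite (fcomp d f) (asg true) (asg false)
  | CSeq c1 c2 => Seq (ccomp d c1) (ccomp d c2)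
  | CFor c => For (vr d) (When (Test aRS (vr d)) (ccomp d.+1 c))
  end.

Definition bind (env : nat -> nat) d v l := if l == d then v else env l.

Section Semantics.
Variable n : nat.
Implicit Types (rho : nat -> nat -> nat -> bool) (env : nat -> nat).

Fixpoint fsem d env rho f : bool :=
  match f with
  | FRel A x y => rho A (env x) (env y)
  | FEq x y => env x == env y
  | FAnd f g => fsem d env rho f && fsem d env rho g
  | FNot f => ~~ fsem d env rho f
  | FEx f => has (fun v => fsem d.+1 (bind env d v) rho f) (iota 0 n)
  end.

Definition updmat rho A x y b A' x' y' :=
  if [&& A' == A, x' == x & y' == y] then b else rho A' x' y'.

Fixpoint csem d env c rho :=
  match c with
  | CAsg A x y f => updmat rho A (env x) (env y) (fsem d env rho f)
  | CSeq c1 c2 => csem d env c2 (csem d env c1 rho)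
  | CFor c => foldl (fun rho v => csem d.+1 (bind env d v) c rho) rho (iota 0 n)
  end.

Let N := n * n + (n * n).+1.
Let ev := eval nregs N.

Definition good st :=
  reg st 0 = 0 /\ forall p, p < N -> arr st aRS p = (p < n * n) && (n %| p).

(** Cut off outside the square, so that a write to one block changes exactly one entry and matrices
    can be compared as functions. *)
Definition mat st A x y := [&& x < n, y < n & arr st A (x * n + y)].

Definition env_ok d env st :=
  forall l, l < d -> env l < n /\ reg st (vr l) = env l * n.

Let N0 : 0 < N. Proof. by rewrite /N; lia. Qed.

Lemma cell_lt i j : i < n -> j < n -> i * n + j < n * n.
Proof. by move=> il jl; have : i.+1 * n <= n * n by [rewrite leq_mul2r il orbT]; rewrite mulSn; lia. Qed.

(* [c] is the number of row starts in [0, p) belonging to rows before [j]. *)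
Definition rows_before j p c :=
  [/\ c <= j, c < j -> p <= c * n & 0 < c -> c.-1 * n < p].

Lemma rows_before0 j : rows_before j 0 0.
Proof. by split. Qed.

Lemma rows_before_start j p c : j <= n -> rows_before j p c ->
  n %| p -> p < j * n -> [/\ p = c * n, c < j & rows_before j p.+1 c.+1].
Proof.
move=> jn [cj H1 H2] /dvdnP[m Em] pj.
have n0 : 0 < n by lia.
have m_j : m < j by move: pj; rewrite Em ltn_pmul2r.
have c_j : c < j.
  rewrite ltn_neqAle cj andbT; apply/eqP => E.
  have : c.-1 * n < m * n by rewrite -Em; apply: H2; lia.
  by rewrite ltn_pmul2r //; lia.
have Ecm : c = m.
  have := H1 c_j; rewrite Em leq_pmul2r // => mc; case: (posnP c) => [c0|c0]; first by lia.
  by have := H2 c0; rewrite Em ltn_pmul2r //; lia.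
split; rewrite ?Em ?Ecm //; split=> //=; rewrite ?mulSn; lia.
Qed.

Lemma rows_before_skip j p c : j <= n -> rows_before j p c ->
  ~~ ((n %| p) && (p < j * n)) -> rows_before j p.+1 c.
Proof.
move=> jn [cj H1 H2] Hp; split=> // [c_j|c0]; last by have := H2 c0; lia.
rewrite ltn_neqAle H1 // andbT; apply/eqP => Ep; move: Hp.
by rewrite Ep dvdn_mull // ltn_pmul2r ?c_j //; lia.
Qed.

Lemma rows_before_end j c : j <= n -> rows_before j N c -> c = j.
Proof.
move=> jn [cj H1 _]; apply/eqP; rewrite eqn_leq cj leqNgt; apply/negP => c_j.
have := H1 c_j; have : c * n <= n * n by rewrite leq_mul2r; lia.
by rewrite /N; lia.
Qed.

Lemma acc_spec st x y i j : good st -> i < n -> j < n ->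
  2 < x -> 2 < y -> reg st x = i * n -> reg st y = j * n ->
  reg (ev (acc x y) st).2 1 = i * n + j.
Proof.
move=> [z0 rs] il jl x2 y2 Ex Ey; rewrite /ev /acc eval_Seq.
set st1 := (eval _ _ _ st).2.
have E1 r : reg st1 r = if r == 1 then i * n else reg st r by rewrite /st1 /= Ex.
pose Inv p s := exists2 c, reg s 1 = i * n + c & rows_before j p c.
suff [c -> /(rows_before_end (ltnW jl)) ->//] :
    Inv N (ev (For 2 (When (And (Test aRS 2) (Lt 2 y)) (Inc 1))) st1).2.
apply: (for_spec N0) => //.
  by exists 0; [rewrite E1 addn0|exact: rows_before0].
move=> p s pN rp [FR FA] [c Ec Hc].
rewrite /ev eval_When -/ev.
have -> : ev (And (Test aRS 2) (Lt 2 y)) s = ((p < n * n) && (n %| p) && (p < j * n), s).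
  have Ry : reg s y = j * n.
    by rewrite FR ?E1 ?ifN // ?inE ?negb_or; lia.
  rewrite /ev /= /track /= rp FA // [arr st1 _ _]rs //.
  by case: (_ && _); rewrite /= ?Ry ?rp.
have jn : j * n <= n * n by rewrite leq_mul2r ltnW ?orbT.
have -> : (p < n * n) && (n %| p) && (p < j * n) = (n %| p) && (p < j * n).
  by case: (n %| p); rewrite ?andbF // !andbT; lia.
case: ifP => [/andP[pn pj]|/negbT Hf]; rewrite /ev /=; last first.
  by exists c => //; apply: rows_before_skip => //; apply: ltnW.
have [Ep cj Hc'] := rows_before_start (ltnW jl) Hc pn pj.
have := cell_lt il jl; rewrite Ec => lc.
have -> : (i * n + c).+1 < N by rewrite /N; lia.
by exists c.+1 => //=; rewrite addnS.
Qed.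

Lemma wreg_fcomp d f r : r \in wreg (fcomp d f) -> (0 < r < 3) || (vr d <= r).
Proof.
elim: f d => [A x y|x y|f IHf g IHg|f IHf|f IHf] d //=; rewrite ?mem_cat ?orbF ?inE.
- by case: r => [|[|[|]]].
- by rewrite orbC => /orP[/IHg|/IHf].
- by move=> /IHf.
move=> H; have {H} : (r == vr d) || (r \in wreg (fcomp d.+1 f)).
  by move: H; rewrite !(inE, mem_cat); case: (r == _) => //=; case: (r \in _).
by case/orP => [/eqP->|/IHf]; rewrite /vr ?leqnn ?orbT //; lia.
Qed.

Lemma vr_wreg_fcomp d f l : l < d -> vr l \notin wreg (fcomp d f).
Proof. by move=> ld; apply/negP => /wreg_fcomp; rewrite /vr; lia. Qed.

Lemma warr_fcomp d f : warr (fcomp d f) = [::].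
Proof.
by elim: f d => //= [f IHf g IHg|f IHf|f IHf] d; rewrite ?IHf ?IHg.
Qed.

Lemma good_frame e st : 0 \notin wreg e -> aRS \notin warr e -> good st -> good (ev e st).2.
Proof. by move=> n0 nRS [z0 rs]; split; rewrite /ev ?eval_reg ?eval_arr. Qed.

Lemma env_ok_frame d env e st : (forall l, l < d -> vr l \notin wreg e) ->
  env_ok d env st -> env_ok d env (ev e st).2.
Proof. by move=> H ok l ld; rewrite /ev eval_reg ?H //; apply: ok. Qed.

Lemma env_ok_bind d env st v : env_ok d env st -> v < n -> reg st (vr d) = v * n ->
  env_ok d.+1 (bind env d v) st.
Proof.
move=> ok vn Ev l; rewrite ltnS leq_eqVlt /bind => /orP[/eqP->|ld]; first by rewrite eqxx.
by rewrite ltn_eqF //; apply: ok.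
Qed.

Lemma mat_frame e st : (forall a, a \notin warr e) -> mat (ev e st).2 = mat st.
Proof.
move=> H; apply: functional_extensionality => a; rewrite /mat /ev.
by rewrite eval_arr.
Qed.

Lemma env_ok_setr d env st y : env_ok d env st -> env_ok d env (setr st (vr d) y).
Proof.
move=> ok l ld; have [H1 H2] := ok l ld; split=> //=.
by case: eqP => //; rewrite /vr; lia.
Qed.

(** Row starts are the multiples of [n] below [n * n]; a loop over all blocks filtered by [aRS] is
    thus a loop over the vertices. *)
Lemma has_rows (phi : pred nat) :
  has (fun p => [&& p < n * n, n %| p & phi (p %/ n)]) (iota 0 N) = has phi (iota 0 n).
Proof.
apply/hasP/hasP => -[x]; rewrite mem_iota add0n => xN; last first.
  move=> Hx; exists (x * n).
    by rewrite mem_iota add0n /N; have := leq_mul (ltnW xN) (leqnn n); lia.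
  by rewrite dvdn_mull // ltn_pmul2r ?xN ?mulnK //; lia.
move=> /and3P[H1 /dvdnP[m Em]]; have n0 : 0 < n by lia.
rewrite Em mulnK // => Hm; exists m => //.
by rewrite mem_iota add0n; move: H1; rewrite Em ltn_pmul2r.
Qed.

Lemma fcomp_correct d f env st : fclosed d f -> good st -> env_ok d env st ->
  (ev (fcomp d f) st).1 = fsem d env (mat st) f.
Proof.
elim: f d env st => [A x y|x y|f IHf g IHg|f IHf|f IHf] d env st.
- move=> /= /and3P[lA xd yd] gs ok; rewrite /ev eval_Seq.
  have [xn Ex] := ok x xd; have [yn Ey] := ok y yd.
  have := acc_spec gs xn yn _ _ Ex Ey; move/(_ isT isT).
  have := @eval_arr nregs N (acc (vr x) (vr y)) st A isT; rewrite -/(ev _ _).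
  move: (ev _ st).2 => s1 EA E1.
  by rewrite /= /track ltnNge lA /= E1 EA /mat xn yn.
- move=> /= /and3P[lx xd yd] gs ok.
  have [xn Ex] := ok x xd; have [yn Ey] := ok y yd.
  by rewrite /ev /= /track lx Ex Ey eqn_pmul2r //; lia.
- move=> /= /andP[cf cg] gs ok.
  have := IHf d env st cf gs ok.
  have ok1 := env_ok_frame (fun l => @vr_wreg_fcomp d f l) ok.
  have gs1 : good (ev (fcomp d f) st).2.
    by apply: good_frame; rewrite ?warr_fcomp //; apply/negP => /wreg_fcomp.
  have := IHg d env _ cg gs1 ok1; rewrite mat_frame; last by move=> a; rewrite warr_fcomp.
  by rewrite /ev /=; case: (eval _ _ (fcomp d f) st) => -[] s1 /= <- <-.
- move=> /= cf gs ok; rewrite -(IHf d env st cf gs ok) /ev /=.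
  by case: (eval _ _ (fcomp d f) st) => -[].
move=> cf gs ok; rewrite [LHS]/= [RHS]/= -has_rows.
pose Inv (p : nat) s := [/\ good s, mat s = mat st & env_ok d env s].
have nF : vr d \notin wreg (fcomp d.+1 f) by apply: vr_wreg_fcomp.
set phi := (X in has X _).
have [|||||->] // := @exists_spec nregs N N0 (vr d)
   (And (Test aRS (vr d)) (fcomp d.+1 f)) st phi Inv.
- by rewrite /= mem_cat negb_or nF.
- by have [] := gs.
- move=> p s y [gs1 Er ok1]; split=> //; exact: env_ok_setr.
move=> p s pN rp _ [gs1 Er ok1].
have -> : eval nregs N (And (Test aRS (vr d)) (fcomp d.+1 f)) s
   = if (p < n * n) && (n %| p) then ev (fcomp d.+1 f) s else (false, s).
  by have [_ rs] := gs1; rewrite /= /track /= rp rs //; case: (_ && _).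
rewrite /phi andbA; case: (boolP (_ && _)) => //= /andP[pn /dvdnP[m Em]].
have n0 : 0 < n by lia.
have ok2 : env_ok d.+1 (bind env d (p %/ n)) s.
  apply: env_ok_bind => //; first by rewrite ltn_divLR.
  by rewrite rp Em mulnK.
rewrite (IHf _ _ _ cf gs1 ok2) Er; split=> // _; split.
- by apply: good_frame => //; rewrite ?warr_fcomp //; apply/negP => /wreg_fcomp.
- by rewrite mat_frame // => a; rewrite warr_fcomp.
by apply: env_ok_frame => // l ld; apply: vr_wreg_fcomp; lia.
Qed.

Lemma wreg_ccomp d c r : r \in wreg (ccomp d c) -> (0 < r < 3) || (vr d <= r).
Proof.
elim: c d => [A x y f|c1 IH1 c2 IH2|c IH] d /=; rewrite ?(inE, mem_cat) ?orbF.
- move=> H; have {H} : [|| r \in wreg (fcomp d f), r == 1 | r == 2].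
    by move: H; case: (r \in wreg _) => //=; case: (r == 1) => //=; case: (r == 2).
  by case/or3P => [/wreg_fcomp|/eqP->|/eqP->].
- by case/or3P => [/IH1|/IH2|/IH2].
move=> H; have {H} : (r == vr d) || (r \in wreg (ccomp d.+1 c)).
  by move: H; case: (r == _) => //=; case: (r \in _).
by case/orP => [/eqP->|/IH]; rewrite /vr ?leqnn ?orbT //; lia.
Qed.

Lemma vr_wreg_ccomp d c l : l < d -> vr l \notin wreg (ccomp d c).
Proof. by move=> ld; apply/negP => /wreg_ccomp; rewrite /vr; lia. Qed.

Fixpoint carr c : seq nat :=
  match c with
  | CAsg A x y f => [:: A]
  | CSeq c1 c2 => carr c1 ++ carr c2
  | CFor c => carr c
  end.

Lemma warr_ccomp d c a : a \in warr (ccomp d c) -> a \in carr c.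
Proof.
elim: c d => [A x y f|c1 IH1 c2 IH2|c IH] d /=; rewrite ?(inE, mem_cat) ?orbF.
- rewrite warr_fcomp; by rewrite /=; case: (a == A).
- by case/or3P => [/IH1|/IH2|/IH2] ->; rewrite ?orbT.
by case/orP => /IH.
Qed.

Lemma RS_carr d c : cclosed d c -> aRS \notin carr c.
Proof.
elim: c d => [A x y f|c1 IH1 c2 IH2|c IH] d /=; last exact: IH.
  by rewrite inE eq_sym => /and5P[].
by rewrite mem_cat negb_or => /andP[/IH1-> /IH2->].
Qed.

Lemma good_ccomp d c st : cclosed d c -> good st -> good (ev (ccomp d c) st).2.
Proof.
move=> cc; apply: good_frame; first by apply/negP => /wreg_ccomp.
by apply/negP => /warr_ccomp; apply/negP/(RS_carr cc).
Qed.

Lemma mat_put A p b st i j : i < n -> j < n -> p = i * n + j ->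
  mat (seta st A p b) = updmat (mat st) A i j b.
Proof.
move=> il jl ->; apply: functional_extensionality => a.
apply: functional_extensionality => x; apply: functional_extensionality => y.
rewrite /mat /updmat /=; case: (a == A) => //=.
case: (ltnP x n) => xn; last by have -> : (x == i) = false by [lia].
case: (ltnP y n) => yn; last by have -> : (y == j) = false by [lia]; rewrite andbF.
by rewrite block_inj.
Qed.

Lemma ccomp_correct d c env st : cclosed d c -> good st -> env_ok d env st ->
  mat (ev (ccomp d c) st).2 = csem d env c (mat st).
Proof.
elim: c d env st => [A x y f|c1 IH1 c2 IH2|c IH] d env st.
- move=> /= /and5P[lA xd yd nA cf] gs ok.
  have [xn Ex] := ok x xd; have [yn Ey] := ok y yd.
  have := fcomp_correct cf gs ok.
  have gs1 : good (ev (fcomp d f) st).2.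
    by apply: good_frame; rewrite ?warr_fcomp //; apply/negP => /wreg_fcomp.
  have ok1 := env_ok_frame (fun l => @vr_wreg_fcomp d f l) ok.
  have := @mat_frame (fcomp d f) st; rewrite warr_fcomp => /(_ (fun a => isT)).
  move: gs1 ok1; rewrite /ev /=; case: (eval _ _ (fcomp d f) st) => b s1 /= gs1 ok1 <- <-.
  have [_ Ex1] := ok1 x xd; have [_ Ey1] := ok1 y yd.
  have P b' : mat (ev (Seq (acc (vr x) (vr y)) (Put A 1 b')) s1).2
      = updmat (mat s1) A (env x) (env y) b'.
    rewrite /ev eval_Seq.
    have := acc_spec gs1 xn yn _ _ Ex1 Ey1; move/(_ isT isT).
    have <- : mat (ev (acc (vr x) (vr y)) s1).2 = mat s1 by apply: mat_frame.
    move: (ev _ s1).2 => s2 E1; rewrite /=.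
    exact: mat_put.
  by case: b; apply: P.
- move=> /= /andP[cc1 cc2] gs ok; rewrite /ev eval_Seq -/ev -(IH1 d env st) //.
  apply: IH2 => //; first exact: good_ccomp.
  by apply: env_ok_frame => // l; apply: vr_wreg_ccomp.
move=> /= cc gs ok.
pose F (rho : nat -> nat -> nat -> bool) v := csem d.+1 (bind env d v) c rho.
(* When the loop is at block [p], the row starts passed so far are those of the first [k] vertices,
   which the fold has processed. *)
pose Inv p s := [/\ good s, env_ok d env s &
  exists2 k, mat s = foldl F (mat st) (iota 0 k) & rows_before n p k].
suff [_ _ [k -> /(rows_before_end (leqnn n)) ->//]] : Inv N (ev (For (vr d) (When (Test aRS (vr d)) (ccomp d.+1 c))) st).2.
apply: (for_spec N0).
- by rewrite /= cats0; apply: vr_wreg_ccomp.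
- by have [] := gs.
- by move=> p s y [gs1 ok1 H]; split=> //; exact: env_ok_setr.
- by split=> //; exists 0 => //; apply: rows_before0.
move=> p s pN rp _ [gs1 ok1 [k Ek Hk]].
rewrite eval_When.
have -> : eval nregs N (Test aRS (vr d)) s = ((p < n * n) && (n %| p), s).
  by have [_ rs] := gs1; rewrite /= /track /= rp rs.
case: ifP => /= [/andP[pn dp]|/negbT Hp]; last first.
  by split=> //; exists k => //; apply: rows_before_skip => //; rewrite andbC.
have [Ep kn Hk'] := rows_before_start (leqnn n) Hk dp pn.
have ok2 : env_ok d.+1 (bind env d k) s by apply: env_ok_bind; rewrite ?rp.
split; first exact: good_ccomp.
  by apply: env_ok_frame => // l ld; apply: vr_wreg_ccomp; lia.
exists k.+1 => //; rewrite (IH _ _ _ cc gs1 ok2) Ek.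
have -> : iota 0 k.+1 = iota 0 k ++ [:: k] by rewrite -addn1 iotaD.
by rewrite foldl_cat.
Qed.

End Semantics.

(** * Preprocessing *)

Definition find_sep := For 2 (When (Test aSEP 2) (Copy 3 2)).

(* The separator is in block [n * n]; [n] itself is found by squaring. *)
Definition find_root :=
  For 8 (Seq (Copy 5 0) (Seq (Rep 6 8 (Rep 7 8 (Inc 5)))
    (When (Test 5 3) (Copy 4 8)))).

Definition mark_rows :=
  Seq (Copy 5 0) (Rep 6 4 (Seq (Put aRS 5 true) (Rep 7 4 (Inc 5)))).

(** The second matrix is moved to the blocks from [0] on, so that [acc] addresses both matrices
    alike. *)
Definition copy_tree :=
  Seq (Copy 5 3) (Seq (Inc 5) (Seq (Copy 1 0)
    (Rep 6 3 (Seq (When (Test aIN 5) (Put aT 1 true)) (Seq (Inc 5) (Inc 1)))))).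

Definition prepare := Seq find_sep (Seq find_root (Seq mark_rows copy_tree)).

Section Prepare.
Variable n : nat.
Let N := n * n + (n * n).+1.
Let ev := eval nregs N.
Let N0 : 0 < N. Proof. by rewrite /N; lia. Qed.

Lemma find_sep_spec st : reg st 0 = 0 ->
  (forall p, p < N -> arr st aSEP p = (p == n * n)) ->
  reg (ev find_sep st).2 3 = n * n.
Proof.
move=> z0 Hs; pose Inv p s := n * n < p -> reg s 3 = n * n.
suff : Inv N (ev find_sep st).2 by apply; rewrite /N; lia.
apply: (for_spec N0) => // p s pN rp [_ FA] Ip.
rewrite eval_When.
have -> : eval nregs N (Test aSEP 2) s = (p == n * n, s).
  by rewrite /= /track /= rp FA // Hs.
case: eqP => [E|ne] /= H; first by rewrite /= rp.
by apply: Ip; lia.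
Qed.

(** [Inc] fails at the last block and the loop goes on regardless, so counting saturates at
    [N.-1]. *)
Lemma rep_inc r m s st : uniq [:: r; m; s] -> reg st 0 = 0 ->
  reg st m < N -> reg st s < N ->
  reg (ev (Rep r m (Inc s)) st).2 s = minn (reg st s + reg st m) N.-1.
Proof.
rewrite /= !inE negb_or andbT => /andP[/andP[rm rs] ms] z0 mN sN.
apply: (rep_spec N0 (Inv := fun x t => reg t s = minn (reg st s + x) N.-1)) => //.
- by rewrite inE.
- by rewrite !inE negb_or eq_sym rm.
- by move=> x t y /=; rewrite eq_sym (negbTE rs).
- by rewrite addn0; lia.
move=> x t xm rx _ Et; rewrite /=.
case: ifP => /= H; last by rewrite Et in H *; lia.
by rewrite eqxx Et; rewrite Et in H; lia.
Qed.

Lemma find_root_spec st : reg st 0 = 0 -> reg st 3 = n * n ->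
  reg (ev find_root st).2 4 = n.
Proof.
move=> z0 E3; pose Inv k s := n < k -> reg s 4 = n.
suff : Inv N (ev find_root st).2 by apply; rewrite /N; nia.
apply: (for_spec N0) => // k s kN r8 [FR _] Ik.
rewrite !eval_Seq.
set s1 := (eval _ _ (Copy 5 0) _).2.
have s10 : reg s1 0 = 0 by rewrite /s1 /= FR.
have s15 : reg s1 5 = 0 by rewrite /s1 /= FR.
have s18 : reg s1 8 = k by rewrite /s1 /=.
have s13 : reg s1 3 = n * n by rewrite /s1 /= FR.
have s14 : reg s1 4 = reg s 4 by [].
clearbody s1; set s2 := (eval _ _ (Rep _ _ _) _).2.
have s23 : reg s2 3 = n * n by rewrite /s2 eval_reg.
have s28 : reg s2 8 = k by rewrite /s2 eval_reg.
have s24 : reg s2 4 = reg s 4 by rewrite /s2 eval_reg.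
have E5 : reg s2 5 = minn (k * k) N.-1.
  have := @rep_spec nregs N N0 6 8 (Rep 7 8 (Inc 5)) s1
    (fun x t => reg t 5 = minn (x * k) N.-1).
  rewrite s18 => H; rewrite /s2. apply: H => //.
  - by rewrite s15 mul0n min0n.
  move=> x t xk rx [FR' _] E5; rewrite rep_inc //.
  - by rewrite (FR' 8) // s18 E5 mulSn; lia.
  - by rewrite (FR' 0).
  - by rewrite (FR' 8) // s18.
  - by rewrite E5; lia.
rewrite eval_When.
have -> : eval nregs N (Test 5 3) s2 = (minn (k * k) N.-1 == n * n, s2).
  by rewrite /= /track /= E5 s23.
(* The saturation value [N.-1 = 2 * n * n] differs from [n * n] unless [n = 0]; in that case [N = 1]
   leaves only [k = 0]. *)
have -> : (minn (k * k) N.-1 == n * n) = (k == n).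
  rewrite /N addnS /= in kN *.
  case: (ltngtP k n) => [lt|gt|->]; last by lia.
    have : k * k < n * n by rewrite ltn_mul.
    by lia.
  have : n * n < k * k by rewrite ltn_mul.
  case: (posnP n) kN => [->|n0 _]; first by lia.
  have : 0 < n * n by rewrite muln_gt0 n0.
  by lia.
case: eqP => [E|ne] /= H; first by rewrite s28.
by rewrite s24; apply: Ik; lia.
Qed.

Lemma mark_rows_spec st : reg st 0 = 0 -> reg st 4 = n ->
  (forall p, p < N -> arr st aRS p = false) ->
  forall p, p < N -> arr (ev mark_rows st).2 aRS p = (p < n * n) && (n %| p).
Proof.
move=> z0 E4 Hrs; rewrite /ev eval_Seq.
set s1 := (eval _ _ (Copy _ _) _).2.
pose Inv x t := reg t 5 = x * n /\
  forall p, p < N -> arr t aRS p = (p < x * n) && (n %| p).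
suff [_] : Inv n (ev (Rep 6 4 (Seq (Put aRS 5 true) (Rep 7 4 (Inc 5)))) s1).2 by [].
have E : reg s1 4 = n by [].
rewrite -{1}E; apply: (rep_spec N0) => //; first by rewrite E /N; nia.
move=> x t; rewrite E => xn rx [FR FA] [E5 Hx]; rewrite eval_Seq.
set t1 := (eval _ _ (Put _ _ _) _).2.
have xn1 : x.+1 * n <= n * n by rewrite leq_mul2r xn orbT.
rewrite mulSn in xn1.
split.
  rewrite rep_inc //; [|by rewrite (FR 0)|by rewrite (FR 4) // E /N; lia|by rewrite E5 /N; lia].
  have -> : reg t1 5 = x * n by [].
  have -> : reg t1 4 = n by rewrite [LHS](FR 4).
  by rewrite mulSn /N addnS /=; lia.
move=> p pN; rewrite eval_arr //= Hx // E5.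
case: eqP => [->|ne]; first by rewrite mulSn dvdn_mull // andbT; lia.
case: (boolP (n %| p)); rewrite ?andbF // !andbT => /dvdnP[m Em].
by rewrite Em !ltn_mul2r ltnS [m <= x]leq_eqVlt; case: (eqVneq m x) => // Emx; case: ne; rewrite Em Emx.
Qed.

Lemma copy_tree_spec st : reg st 0 = 0 -> reg st 3 = n * n ->
  (forall p, p < N -> arr st aT p = false) ->
  forall p, p < n * n -> arr (ev copy_tree st).2 aT p = arr st aIN ((n * n).+1 + p).
Proof.
move=> z0 E3 Ht; rewrite /ev 3!eval_Seq.
set s1 := (eval _ _ (Copy 5 3) _).2.
set s2 := (eval _ _ (Inc 5) s1).2.
set s3 := (eval _ _ (Copy 1 0) _).2.
(* After the last entry, register 5 cannot advance past the end of the tape, hence the [minn]. *)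
pose Inv x t := [/\ reg t 1 = x, reg t 5 = minn ((n * n).+1 + x) N.-1 &
  forall p, p < N -> arr t aT p = (p < x) && arr st aIN ((n * n).+1 + p)].
have E25 : reg s2 5 = minn ((n * n).+1) N.-1.
  rewrite /s2 /s1 /= E3; case: ifP => H /=; first by rewrite /N; rewrite /N in H; lia.
  by rewrite /N in H *; lia.
have E2 r : r != 5 -> reg s2 r = reg st r.
  move=> ne; rewrite /s2 eval_reg ?inE // /s1 /=.
  by rewrite (negbTE ne).
have A2 : arr s2 = arr st by rewrite /s2 /=; case: ifP.
have E33 : reg s3 3 = n * n by rewrite /s3 /= E2.
suff [_ _ H] : Inv (n * n) (ev (Rep 6 3 (Seq (When (Test aIN 5) (Put aT 1 true)) (Seq (Inc 5) (Inc 1)))) s3).2.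
  by move=> p pn; rewrite H ?pn // /N; lia.
rewrite -{1}E33; apply: (rep_spec N0) => //.
- by rewrite /s3 /= E2.
- by rewrite E33 /N; lia.
- split; rewrite ?addn0 //; first by rewrite /s3 /= E2.
  by move=> p pN; rewrite /s3 /= A2 Ht.
move=> x t; rewrite E33 => xn rx [FR FA] [E1 E5 Hx]; rewrite !eval_Seq eval_When.
have -> : eval nregs N (Test aIN 5) t = (arr st aIN ((n * n).+1 + x), t).
  rewrite /= /track /= FA // /s3 /= A2 E5; congr (arr _ _ _, _).
  by rewrite /N; lia.
set t1 := (if _ then _ else _).
have T1r : reg t1 = reg t by rewrite /t1; case: ifP.
have T1a p : p < N -> arr t1 aT p = (p < x.+1) && arr st aIN ((n * n).+1 + p).
  move=> pN; rewrite /t1; case: ifP => /= H; last first.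
    by rewrite Hx // ltnS [p <= x]leq_eqVlt; case: (eqVneq p x) => //= ->; rewrite ltnn H.
  by rewrite E1 Hx // ltnS [p <= x]leq_eqVlt; case: (eqVneq p x) => //= ->; rewrite H.
set t2 := (eval _ _ (Inc 5) _).2.
have T2 : reg t2 5 = minn ((n * n).+1 + x.+1) N.-1.
  rewrite /t2 /= T1r E5; case: ifP => /= H; rewrite /N in H *; first by lia.
  by rewrite T1r E5 /N; lia.
have T2r : reg t2 1 = x by rewrite /t2 eval_reg // T1r.
have T2a : arr t2 = arr t1 by rewrite /t2 /=; case: ifP.
rewrite /= T2r; have -> : x.+1 < N by rewrite /N; lia.
by split=> //= p pN; rewrite T2a T1a.
Qed.

Lemma prepare_spec st : reg st 0 = 0 ->
  (forall p, p < N -> arr st aSEP p = (p == n * n)) ->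
  (forall p, p < N -> arr st aRS p = false) ->
  (forall p, p < N -> arr st aT p = false) ->
  [/\ good n (ev prepare st).2, arr (ev prepare st).2 aIN = arr st aIN &
    forall p, p < n * n -> arr (ev prepare st).2 aT p = arr st aIN ((n * n).+1 + p)].
Proof.
move=> z0 Hsep Hrs Ht.
have E : ev prepare st = ev copy_tree (ev mark_rows (ev find_root (ev find_sep st).2).2).2.
  by rewrite /ev 3!eval_Seq.
rewrite E {E}.
have := find_sep_spec z0 Hsep.
have A1 a : arr (ev find_sep st).2 a = arr st a by apply: eval_arr.
have R1 : reg (ev find_sep st).2 0 = 0 by rewrite /ev eval_reg.
move: (ev find_sep st).2 A1 R1 => s1 A1 R1 E13.
have := find_root_spec R1 E13.
have A2 a : arr (ev find_root s1).2 a = arr st a by rewrite -A1; apply: eval_arr.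
have R2 : reg (ev find_root s1).2 0 = 0 by rewrite /ev eval_reg.
have E23 : reg (ev find_root s1).2 3 = n * n by rewrite /ev eval_reg.
move: (ev find_root s1).2 A2 R2 E23 => s2 A2 R2 E23 E24.
have Hrs2 p : p < N -> arr s2 aRS p = false by rewrite A2; apply: Hrs.
have := mark_rows_spec R2 E24 Hrs2.
have A3 a : a != aRS -> arr (ev mark_rows s2).2 a = arr st a.
  by move=> ne; rewrite -A2; apply: eval_arr; rewrite /= ?inE (negbTE ne).
have R3 : reg (ev mark_rows s2).2 0 = 0 by rewrite /ev eval_reg.
have E33 : reg (ev mark_rows s2).2 3 = n * n by rewrite /ev eval_reg.
move: (ev mark_rows s2).2 A3 R3 E33 => s3 A3 R3 E33 H3.
have Ht3 p : p < N -> arr s3 aT p = false by rewrite A3 //; apply: Ht.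
have H4 := copy_tree_spec R3 E33 Ht3.
split.
- split; first by rewrite /ev eval_reg.
  by move=> p pN; rewrite /ev eval_arr // H3.
- by rewrite /ev eval_arr // A3.
by move=> p pn; rewrite H4 // A3.
Qed.

End Prepare.

(** * Lexicographic comparison of labels *)

(** The label of a vertex whose numbered neighbours sit at the positions [k < i] with [P k]. [lexb]
    compares two such labels from the latest position downwards. *)
Definition lab (P : pred nat) i := [seq k.+1 | k <- rev (iota 0 i) & P k].

Fixpoint lexb (P Q : pred nat) i :=
  if i is k.+1 then ((P k == Q k) && lexb P Q k) || (~~ P k && Q k) else true.

Lemma lab_S P i : lab P i.+1 = if P i then i.+1 :: lab P i else lab P i.
Proof.
rewrite /lab -addn1 iotaD rev_cat /= add0n.
by case: (P i); rewrite //= addn1.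
Qed.

Lemma lab_le P i k : k \in lab P i -> k <= i.
Proof.
case/mapP => j; rewrite mem_filter mem_rev mem_iota => /andP[_ lj] ->.
by rewrite add0n in lj.
Qed.

(** Labels are decreasing. At the highest position where [P] and [Q] differ, the label that lacks
    this number either has ended or continues with a smaller one. *)
Lemma lex_lab P Q i : lex_le (lab P i) (lab Q i) = lexb P Q i.
Proof.
elim: i => // i IH; rewrite !lab_S /=; case: (P i); case: (Q i) => //=.
- by rewrite ltnn eqxx IH orbF.
- case E: (lab Q i) => [//|k t].
  have /lab_le ki : k \in lab Q i by rewrite E mem_head.
  by apply/negbTE; rewrite negb_or negb_and -leqNgt; apply/andP; split; lia.
- case E: (lab P i) => [//|k t] /=.
  have /lab_le ki : k \in lab P i by rewrite E mem_head.
  by rewrite ltnS ki.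
by rewrite IH orbF.
Qed.

(** Only the last difference decides, so every advantage of [P] must be overruled by a later
    advantage of [Q]. This form is first-order in the positions and can be tested by a formula. *)
Lemma lexbP (P Q : pred nat) i : reflect
  (forall a, a < i -> P a -> ~~ Q a -> exists d, [/\ a < d, d < i, Q d & ~~ P d])
  (lexb P Q i).
Proof.
apply: (iffP idP) => [|H].
  elim: i => // i IH /= /orP[/andP[/eqP E L] a ai Pa Qa|/andP[Pi Qi] a ai Pa Qa].
    have lai : a < i by rewrite ltn_neqAle -ltnS ai andbT; apply: contraNneq Qa => E2; rewrite E2 -E -E2.
    by have [d [ad di Qd Pd]] := IH L a lai Pa Qa; exists d; split=> //; apply: ltnW.
  exists i; split=> //.
  by rewrite ltn_neqAle -ltnS ai andbT; apply: contraNneq Pi => <-.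
elim: i H => //= i IH H.
case: (boolP (P i)) => Pi; case: (boolP (Q i)) => Qi //=; rewrite ?orbF ?orbT.
- apply: IH => a ai Pa Qa; have [d [ad di Qd Pd]] := H a (ltnW ai) Pa Qa.
  exists d; split=> //; rewrite ltn_neqAle -ltnS di andbT.
  by apply: contraNneq Pd => ->.
- by have [d [ad di _ _]] := H i (ltnSn i) Pi Qi; lia.
apply: IH => a ai Pa Qa; have [d [ad di Qd Pd]] := H a (ltnW ai) Pa Qa.
exists d; split=> //; rewrite ltn_neqAle -ltnS di andbT.
by apply: contraTneq Qd => ->.
Qed.

Lemma lexb_total P Q i : lexb P Q i || lexb Q P i.
Proof. by elim: i => //= i; case: (P i); case: (Q i); case: lexb; case: lexb. Qed.

Lemma lexb_trans Q P R i : lexb P Q i -> lexb Q R i -> lexb P R i.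
Proof.
elim: i => //= i; case: (P i); case: (Q i); case: (R i) => //=; rewrite ?orbF //.
Qed.

Lemma eq_lexb P Q P' Q' i : (forall k, k < i -> P k = P' k) ->
  (forall k, k < i -> Q k = Q' k) -> lexb P Q i = lexb P' Q' i.
Proof.
elim: i => //= i IH HP HQ; rewrite HP // HQ // IH // => k ki.
  by apply/HP/ltnW.
by apply/HQ/ltnW.
Qed.

Lemma seq_max (A : eqType) (le : rel A) (s : seq A) x0 : total le -> transitive le ->
  x0 \in s -> exists2 x, x \in s & forall y, y \in s -> le y x.
Proof.
move=> tot tr; elim: s x0 => // x s IH x0 _.
case: s IH => [_|y s /(_ y (mem_head _ _)) [z zs Hz]].
  by exists x; rewrite ?mem_head // => y; rewrite inE => /eqP->; have /orP[] := tot x x.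
case/orP: (tot x z) => le_xz.
  by exists z; [rewrite inE zs orbT|move=> t; rewrite inE => /orP[/eqP->//|/Hz]].
exists x; first exact: mem_head.
move=> t; rewrite inE => /orP[/eqP->|/Hz tz]; first by have /orP[] := tot x x.
exact: tr tz le_xz.
Qed.

(** * Rooted trees *)

(** The edge relation only forbids entering [a]; the condition [s != a] deals with paths that start
    there. *)
Definition vis (n : nat) (T : rel 'I_n) (s a x : 'I_n) :=
  (s != a) && connect (fun u v => T u v && (v != a)) s x.

Section Parents.
Variables (n : nat) (s : 'I_n) (par : 'I_n -> 'I_n) (rk : 'I_n -> nat) (T : rel 'I_n).

(** The rank makes the parent function well-founded. It will be the position in the ordering when
    the tree comes from a search, and the distance from [s] when the tree is given. *)
Definition parent_structure :=
  (forall x, x != s -> rk (par x) < rk x) /\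
  (forall x y, T x y = (x != s) && (y == par x) || (y != s) && (x == par y)).

Inductive panc (a : 'I_n) : 'I_n -> Prop :=
  | panc_refl : panc a a
  | panc_step x : x != s -> panc a (par x) -> panc a x.

Lemma panc_par a x : panc a x -> a != x -> x != s /\ panc a (par x).
Proof. by move=> H; case: x / H => [|y ne Hy] //; rewrite eqxx. Qed.

Lemma panc_root a : panc a s -> a = s.
Proof. by move=> H; apply/eqP/contraT => /(panc_par H)[]; rewrite eqxx. Qed.

(** Both [a] and [b] lie on the single upward path from [x]. *)
Lemma panc_total a b x : panc a x -> panc b x -> panc a b \/ panc b a.
Proof.
move=> Ha; elim: Ha b => [b|y ne Hay IH b Hb]; first by right.
case: (eqVneq b y) => [->|nb]; first by left; apply: panc_step.
by apply: IH; have [] := panc_par Hb nb.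
Qed.

Hypothesis PS : parent_structure.
Let rk_par x : x != s -> rk (par x) < rk x. Proof. by case: PS => H _; apply: H. Qed.
Let TE x y : T x y = (x != s) && (y == par x) || (y != s) && (x == par y).
Proof. by case: PS => _. Qed.

Lemma rk_ind (P : 'I_n -> Prop) :
  (forall x, (x != s -> P (par x)) -> P x) -> forall x, P x.
Proof.
move=> H x; have [k lek] := ubnP (rk x); elim: k x lek => // k IH x lek.
by apply: H => ne; apply: IH; have := rk_par ne; lia.
Qed.

Lemma panc_rk a x : panc a x -> a = x \/ rk a < rk x.
Proof.
elim=> [|y ys _ [->|lt]]; first by left.
  by right; apply: rk_par.
by right; apply: ltn_trans (rk_par ys).
Qed.

Lemma visP a x : reflect (panc a x) (~~ vis T s a x).
Proof.
(* The subtree of [a] can be entered only through [a], which the path avoids. *)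
have H1 : vis T s a x -> ~ panc a x.
  case/andP => sa /connectP[p]; elim/last_ind: p x => [|p y IH] x /=.
    by move=> _ -> /panc_root E; rewrite E eqxx in sa.
  rewrite rcons_path last_rcons => /andP[Hp /andP[Ty ya]] -> Hay.
  have Nu := IH _ Hp erefl.
  have [ys Hpy] : y != s /\ panc a (par y) by apply: panc_par => //; rewrite eq_sym.
  rewrite TE in Ty; case/orP: Ty => /andP[us /eqP Ey].
    by apply: Nu; apply: panc_step => //; rewrite -Ey.
  by apply: Nu; rewrite Ey.
have H2 : panc a x \/ vis T s a x.
  elim/rk_ind: x {H1} => x IH; case: (eqVneq a x) => [->|ax]; first by left; apply: panc_refl.
  case: (eqVneq x s) => [E|xs]; first by right; rewrite /vis E connect0 andbT -E eq_sym.
  case: (IH xs) => [H|/andP[sa Hc]]; [by left; apply: panc_step|right].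
  rewrite /vis sa; apply: connect_trans Hc (connect1 _).
  by rewrite TE xs eqxx orbT eq_sym.
apply: (iffP idP) => [nV|Ha]; first by case: H2 => // V; rewrite V in nV.
by apply/negP => /H1.
Qed.

End Parents.

(** Every vertex other than [s] has a neighbour of smaller breadth-first level, which becomes its
    parent; the number of edges leaves no room for further ones. *)
Lemma spanning_tree_parents (n : nat) (G T : rel 'I_n) (s : 'I_n) :
  spanning_tree G T -> exists par rk, parent_structure s par rk T.
Proof.
move=> [[[symT irrT] conT] [_ cardT]].
pose lvl k := iter k (fun A : {set 'I_n} => A :|: [set y | [exists x in A, T x y]]) [set s].
have ex x : exists k, x \in lvl k.
  have /connectP[p Hp ->] := conT s x; elim/last_ind: p Hp => [_|p y IH].
    by exists 0; rewrite inE.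
  rewrite rcons_path last_rcons => /andP[/IH[k Hk] Ty]; exists k.+1.
  by rewrite /= !inE; apply/orP; right; apply/existsP; exists (last s p); rewrite Hk.
pose rk x := ex_minn (ex x).
have nearer x : x != s -> exists y, T x y && (rk y < rk x).
  move=> xs; rewrite {2}/rk; case: ex_minnP => -[|k] Hk Hmin.
    by rewrite inE (negbTE xs) in Hk.
  rewrite /= !inE in Hk; case/orP: Hk => [/Hmin|]; first by rewrite ltnn.
  case/existsP => y /andP[yk Ty]; exists y; rewrite symT Ty /= /rk.
  by case: ex_minnP => m _ /(_ _ yk).
pose par x := odflt x [pick y | T x y && (rk y < rk x)].
have parP x : x != s -> T x (par x) && (rk (par x) < rk x).
  move=> /nearer[y Hy]; rewrite /par; case: pickP => [z //|/(_ y)].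
  by rewrite Hy.
exists par, rk; split=> [x xs|x y]; first by case/andP: (parP x xs).
apply/idP/idP; last first.
  case/orP => /andP[xs /eqP->]; last rewrite symT.
    by case/andP: (parP x xs).
  by case/andP: (parP y xs).
(* The edges from the n - 1 vertices other than the root to their parents are
   distinct, hence they are all the edges. *)
pose E := [set p : 'I_n * 'I_n | T p.1 p.2 && (p.1 < p.2)%N].
pose e (x : 'I_n) := if x < par x then (x, par x) else (par x, x).
have eE z : z != s -> e z \in E.
  move=> zs; have /andP[Tz rz] := parP z zs; rewrite inE /e; case: ltnP => /= H; first by rewrite Tz.
  rewrite symT Tz ltn_neqAle H andbT; apply/eqP => /val_inj H2.
  by rewrite H2 ltnn in rz.
(* Two vertices with the same edge would be each other's parents, and the rank would drop both
   ways. *)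
have inj : {in [set~ s] &, injective e}.
  move=> u v; rewrite !inE => us vs; have /andP[_ ru] := parP u us; have /andP[_ rv] := parP v vs.
  rewrite /e; case: ifP => _; case: ifP => _ [] E1 E2 //.
  - by rewrite -E1 in rv; rewrite E2 in ru; lia.
  - by rewrite -E2 in rv; rewrite E1 in ru; lia.
have EE : e @: [set~ s] = E.
  apply/eqP; rewrite eqEcard; apply/andP; split.
    by apply/subsetP => _ /imsetP[z zs ->]; apply: eE; rewrite !inE in zs.
  by rewrite card_in_imset // cardsC1 card_ord -cardT.
have edge u v : T u v -> u < v -> (u != s) && (v == par u) || (v != s) && (u == par v).
  move=> Tuv uv; have : (u, v) \in E by rewrite inE Tuv.
  rewrite -EE => /imsetP[z]; rewrite !inE /e => zs.
  by case: ifP => _ [-> ->]; rewrite zs eqxx ?orbT.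
move=> Txy; case: (ltngtP x y) => [|lt|/val_inj E2]; first exact: edge.
  by rewrite orbC; apply: edge => //; rewrite symT.
by rewrite E2 irrT in Txy.
Qed.

(** * Characterization of the L-trees of lexicographic depth first searches *)

Section Characterization.
Variables (n : nat) (G T : rel 'I_n).

(* With [~~ vis T s a x] meaning that [a] is an ancestor of [x] in [T] rooted at
   [s]: every edge of [G] joins comparable vertices, and a descendant [x] of [c]
   never has a larger label than [c] when [c] is visited. *)
Definition check (s : 'I_n) : Prop :=
  (forall x y, G x y -> ~~ vis T s x y || ~~ vis T s y x) /\
  (forall c x a, ~~ vis T s c x -> ~~ vis T s a c -> a != c -> G a x -> ~~ G a c ->
     exists d, [&& ~~ vis T s a d, ~~ vis T s d c, G d c & ~~ G d x]).

Lemma ldfs_labelE s (sigma : seq 'I_n) i u : uniq sigma -> i <= size sigma ->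
  ldfs_label G s sigma i u =
    lab (fun k => G (nth s sigma k) u) i ++ (if u == s then [:: 0] else [::]).
Proof.
move=> us si; rewrite /ldfs_label /lab -(map_nth_iota0 s si) -map_rev filter_map -map_comp.
congr (_ ++ _); apply/eq_in_map => k; rewrite mem_filter mem_rev mem_iota /= add0n => /andP[_ ki].
by rewrite index_uniq //; apply: leq_trans si.
Qed.

Lemma ltree_parentE (sigma : seq 'I_n) x y : uniq sigma -> x \in sigma ->
  ltree_parent G sigma x y =
  [&& index y sigma < index x sigma, G x y &
    [forall w, (index y sigma < index w sigma < index x sigma) ==> ~~ G x w]].
Proof.
move=> us xs; rewrite /ltree_parent in_take_leq ?index_size //; congr [&& _, _ & _].
apply/allP/forallP => [H w|H w].
  apply/implyP => /andP[l1 l2]; apply: H.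
  have ws : w \in sigma by rewrite -index_mem; apply: leq_trans l2 (index_size _ _).
  have -> : w = nth x (drop (index y sigma).+1 (take (index x sigma) sigma)) (index w sigma - (index y sigma).+1).
    by rewrite nth_drop subnKC // nth_take // nth_index.
  rewrite mem_nth // size_drop size_take index_mem xs; lia.
move/(nthP x) => [i]; rewrite size_drop size_take index_mem xs => il <-.
have si : index x sigma <= size sigma by apply: index_size.
rewrite nth_drop nth_take; last by lia.
have := H (nth x sigma ((index y sigma).+1 + i)); rewrite index_uniq //; last by apply: leq_trans si; rewrite -ltn_subRL.
by move/implyP; apply; rewrite -ltn_subRL il andbT addSn ltnS leq_addr.
Qed.

Lemma connect_cross (A : pred 'I_n) x y : connect G x y -> A x -> ~~ A y ->
  exists p q, [/\ A p, ~~ A q & G p q].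
Proof.
case/connectP => p; elim: p x => [|z p IH] x /= => [_ -> ->//|/andP[Gxz Hp] Ey Ax nAy].
case: (boolP (A z)) => Az; last by exists x, z.
exact: IH Hp Ey Az nAy.
Qed.

Lemma check_of_ldfs : connected_graph G -> LDFS_Ltree G T -> exists s, check s.
Proof.
move=> [[symG irrG] conG] [sigma [[/andP[us /eqP sz] [s H]] HT]].
have inS x : x \in sigma.
  have E : #|sigma| = #|'I_n| by rewrite card_ord (card_uniqP us) sz.
  by have /(subset_cardP E) -> : sigma \subset 'I_n by apply/subsetP.
pose idx x := index x sigma.
have idx_lt x : idx x < n by rewrite -sz index_mem inS.
have nthK x : nth s sigma (idx x) = x by apply: nth_index.
have idxK k : k < n -> idx (nth s sigma k) = k by move=> kn; rewrite /idx index_uniq ?sz.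
have idx_inj x y : idx x = idx y -> x = y by move=> E; rewrite -(nthK x) E nthK.
have n0 : 0 < n by apply: leq_ltn_trans (idx_lt s).
(* At step [0] only the start vertex has a non-empty label. *)
have idx_s : idx s = 0.
  have := H 0 n0 s; rewrite take0 in_nil !ldfs_labelE // => /(_ isT).
  rewrite /lab /= eqxx; case: eqP => // E _.
  by rewrite -{1}E idxK.
have idx0 x : 0 < idx x -> x != s by apply: contraTneq => ->; rewrite idx_s.
(* When [v] was chosen, [u] was still available and had the number of [a] in its label, unlike [v];
   so some later number speaks for [v]. *)
have L v u a : idx a < idx v -> idx v <= idx u -> G a u -> ~~ G a v ->
    exists d, [/\ idx a < idx d, idx d < idx v, G d v & ~~ G d u].
  move=> av vu Gau nGav.
  have vs : v != s by apply: idx0; apply: leq_ltn_trans av.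
  have us' : u != s by apply: idx0; apply: leq_trans vu; apply: leq_ltn_trans av.
  have := H (idx v) (idx_lt v) u.
  rewrite in_take_leq; last by rewrite sz ltnW.
  rewrite -leqNgt => /(_ vu); rewrite nthK !ldfs_labelE ?sz 1?ltnW //.
  rewrite (negbTE vs) (negbTE us') !cats0 lex_lab => /lexbP /(_ _ av).
  rewrite nthK => /(_ Gau nGav)[d [ad dv Gd nGd]]; exists (nth s sigma d).
  by rewrite idxK //; apply: ltn_trans dv _.
(* A path from [s] leaves the vertices before [x] by an edge [p q]. If [p] is not adjacent to [x],
   then [q] would beat [x], unless [x] has the earlier neighbour that [L] supplies. *)
have earlier x : x != s -> exists y, (idx y < idx x) && G x y.
  move=> xs; have x0 : 0 < idx x.
    by rewrite lt0n; apply: contraNneq xs => E; apply/eqP/idx_inj; rewrite E idx_s.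
  have [||p [q [px qx Gpq]]] := @connect_cross (fun y => idx y < idx x) s x (conG s x).
  - by rewrite idx_s.
  - by rewrite ltnn.
  rewrite -leqNgt in qx.
  case: (boolP (G p x)) => Gpx; first by exists p; rewrite px symG.
  by have [d [_ dx Gdx _]] := L x q p px qx Gpq Gpx; exists d; rewrite dx symG.
pose par x := odflt x [pick y | ltree_parent G sigma x y].
have parP x : x != s -> ltree_parent G sigma x (par x).
  move=> /earlier[y0 Hy0].
  have [y Hy] : exists y, ltree_parent G sigma x y.
    case: (@arg_maxnP _ y0 (fun y => (idx y < idx x) && G x y) idx Hy0) => y /andP[yx Gxy] Hmax.
    exists y; rewrite ltree_parentE // yx Gxy /=; apply/forallP => w; apply/implyP => /andP[yw wx].
    by apply/negP => Gxw; have := Hmax w; rewrite wx Gxw => /(_ isT) /(leq_trans yw); rewrite ltnn.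
  by rewrite /par; case: pickP => [z //|/(_ y)]; rewrite Hy.
have lpE x y : ltree_parent G sigma x y = (x != s) && (y == par x).
  apply/idP/andP => [Hy|[xs /eqP->]]; last exact: parP.
  move: (Hy); rewrite ltree_parentE // => /and3P[yx Gxy /forallP my].
  have xs : x != s by apply: idx0; apply: leq_ltn_trans yx.
  split=> //; move: (parP x xs); rewrite ltree_parentE // => /and3P[px Gxp /forallP mp].
  apply/eqP/idx_inj; case: (ltngtP (idx y) (idx (par x))) => // lt.
    by have := my (par x); rewrite lt px Gxp.
  by have := mp y; rewrite lt yx Gxy.
have PS : parent_structure s par idx T.
  split=> [x xs|x y]; last by rewrite -HT /ltree !lpE.
  by have := parP x xs; rewrite ltree_parentE // => /and3P[].
have par_last x w : x != s -> idx (par x) < idx w -> idx w < idx x -> ~~ G x w.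
  move=> xs l1 l2; have := parP x xs; rewrite ltree_parentE // => /and3P[_ _ /forallP/(_ w)].
  by rewrite [X in X ==> _]/= -/(idx _) l1 l2.
(* An edge from [a] to [b] makes all vertices after [a], up to [b], descendants of [a]. The parent
   of such a [y] cannot precede [a]: either [a] or the [d] from [L] would be a later neighbour of
   [y] before [y]. *)
have D y a b : G a b -> idx a < idx y -> idx y <= idx b -> panc s par a y.
  elim/(rk_ind PS): y => y IH Gab ay yb.
  have ys : y != s by apply: idx0; apply: leq_ltn_trans ay.
  have ap : idx a <= idx (par y).
    rewrite leqNgt; apply/negP => pa.
    have nGya := par_last _ _ ys pa ay.
    have nGay : ~~ G a y by rewrite symG.
    have [d [ad dy Gdy _]] := L y b a ay yb Gab nGay.
    by have := par_last _ _ ys (ltn_trans pa ad) dy; rewrite symG Gdy.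
  apply: panc_step => //; move: ap; rewrite leq_eqVlt => /orP[/eqP/idx_inj->|ap].
    exact: panc_refl.
  apply: IH => //; apply: leq_trans yb; apply: ltnW.
  by case: PS => /(_ _ ys).
exists s; split=> [x y Gxy|c x a /(visP PS) cx /(visP PS) ac neq_ac Gax nGac].
  case: (ltngtP (idx x) (idx y)) => [lt|lt|/idx_inj E].
  - by apply/orP; left; apply/(visP PS); apply: D Gxy lt (leqnn _).
  - by apply/orP; right; apply/(visP PS); apply: (D _ _ x) => //; rewrite symG.
  by rewrite E irrG in Gxy.
have [Eac|lac] := panc_rk PS ac; first by rewrite Eac eqxx in neq_ac.
have [Ecx|lcx] := panc_rk PS cx; first by rewrite Ecx Gax in nGac.
have [d [ad dc Gdc nGdx]] := L c x a lac (ltnW lcx) Gax nGac.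
have Hdc : panc s par d c by apply: D Gdc dc (leqnn _).
exists d; rewrite Gdc nGdx !andbT; apply/andP; split; last by apply/(visP PS).
apply/(visP PS); case: (panc_total ac Hdc) => // /(panc_rk PS)[E|lt].
  by rewrite E ltnn in ad.
by have := ltn_trans lt ad; rewrite ltnn.
Qed.

(** * Building an LDFS ordering from a tree that passes the check *)

Section Construction.
Variables (s : 'I_n) (par : 'I_n -> 'I_n) (rk : 'I_n -> nat).
Hypotheses (PS : parent_structure s par rk T) (cs : check s).

(** An initial segment of a search, closed under parents. The rule of choice omits the label [(0)]
    of [s], which matters only at position [0], where [s] is prescribed. *)
Definition prefix_ok (pre : seq 'I_n) :=
  [/\ uniq pre, s \in pre, nth s pre 0 = s,
    forall x, x \in pre -> x != s -> par x \in pre /\ index (par x) pre < index x pre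
    & forall i u, i < size pre -> u \notin take i pre ->
        lexb (fun k => G (nth s pre k) u) (fun k => G (nth s pre k) (nth s pre i)) i].

Lemma prefix_panc pre a x : prefix_ok pre -> panc s par a x -> x \in pre ->
  a \in pre /\ (a = x \/ index a pre < index x pre).
Proof.
move=> [_ _ _ Hp _]; elim=> [|y ys _ IH] Hy; first by split=> //; left.
have [py lt] := Hp y Hy ys; have [ap Hap] := IH py; split=> //; right.
by case: Hap => [->//|lt2]; apply: ltn_trans lt2 lt.
Qed.

Lemma prefix_extend pre : connected_graph G -> prefix_ok pre -> size pre < n ->
  exists c, prefix_ok (rcons pre c).
Proof.
move=> [[symG irrG] _] ok szn; have [upre spre h0 Hp Hl] := ok.
have [x0 x0N] : exists x, x \notin pre.
  apply/existsP; rewrite -[[exists x, _]]negbK negb_exists; apply/negP => /forallP Hall.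
  suff : size (enum 'I_n) <= size pre by rewrite size_enum_ord leqNgt szn.
  by apply: uniq_leq_size (enum_uniq _) _ => x _; have := Hall x; rewrite negbK.
pose le u v := lexb (fun k => G (nth s pre k) u) (fun k => G (nth s pre k) v) (size pre).
have [x xN Hx] : exists2 x, x \notin pre & forall y, y \notin pre -> le y x.
  have [|||x] := @seq_max _ le [seq x <- enum 'I_n | x \notin pre] x0.
  - by move=> u v; apply: lexb_total.
  - by move=> v u w; apply: lexb_trans.
  - by rewrite mem_filter x0N mem_enum.
  rewrite mem_filter => /andP[xN _] Hx; exists x => // y yN.
  by apply: Hx; rewrite mem_filter yN mem_enum.
(* The highest unvisited ancestor of [x] has a visited parent, and a label at
   least as large as that of [x]. *)
have [c [cN cs' pc cx]] : exists c, [/\ c \notin pre, c != s, par c \in pre & panc s par c x].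
  elim/(rk_ind PS): x xN {Hx} => x IH xN.
  have xs : x != s by apply: contraNneq xN => ->.
  case: (boolP (par x \in pre)) => px; first by exists x; split=> //; apply: panc_refl.
  by have [c [H1 H2 H3 H4]] := IH xs px; exists c; split=> //; apply: panc_step.
(* A visited neighbour [a] of [x] is an ancestor of [c] as well. If it is not adjacent to [c], the
   [d] of [check] is a proper ancestor of [c], hence visited, and comes after [a]: its number speaks
   for [c]. *)
have le_xc : le x c.
  apply/lexbP => k kl Gkx nGkc; set a := nth s pre k in Gkx nGkc.
  have ap : a \in pre by apply: mem_nth.
  have ax : panc s par a x.
    case/orP: (cs.1 _ _ Gkx) => /(visP PS) // /(prefix_panc ok)/(_ ap)[].
    by rewrite (negbTE xN).
  have ac : panc s par a c.
    case: (panc_total ax cx) => // /(prefix_panc ok)/(_ ap)[].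
    by rewrite (negbTE cN).
  have nac : a != c by apply: contraNneq cN => <-.
  have [d /and4P[/(visP PS) ad /(visP PS) dc Gdc nGdx]] :=
    cs.2 _ _ _ (introT (visP PS c x) cx) (introT (visP PS a c) ac) nac Gkx nGkc.
  have ndc : d != c by apply: contraTneq Gdc => ->; rewrite irrG.
  have [_ /(prefix_panc ok)/(_ pc)[dp _]] := panc_par dc ndc.
  have [_ [E|lt]] := prefix_panc ok ad dp; first by rewrite -E Gkx in nGdx.
  exists (index d pre); rewrite index_mem nth_index //; split=> //.
  by rewrite /a index_uniq in lt.
exists c; split.
- by rewrite rcons_uniq cN.
- by rewrite mem_rcons inE spre orbT.
- by rewrite nth_rcons; case: ltnP => //; case: (pre) spre.
- move=> y; rewrite mem_rcons inE => /orP[/eqP->|yp] ys.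
    rewrite mem_rcons inE pc orbT; split=> //.
    by rewrite -cats1 !index_cat pc (negbTE cN) /= eqxx addn0 index_mem.
  have [py lt] := Hp y yp ys; rewrite mem_rcons inE py orbT; split=> //.
  by rewrite -cats1 !index_cat py yp.
move=> i u; rewrite size_rcons ltnS => il.
have Et : take i (rcons pre c) = take i pre by rewrite -cats1 takel_cat.
rewrite Et => uN.
have En k : k < size pre -> nth s (rcons pre c) k = nth s pre k.
  by move=> kl; rewrite nth_rcons kl.
move: il; rewrite leq_eqVlt => /orP[/eqP Ei|il].
  rewrite (eq_lexb (P' := fun k => G (nth s pre k) u) (Q' := fun k => G (nth s pre k) c)); last 2 first.
  - by move=> k ki; rewrite En // -Ei.
  - by move=> k ki; rewrite En -?Ei // Ei nth_rcons ltnn eqxx.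
  by rewrite Ei; apply: lexb_trans le_xc; apply: Hx; rewrite Ei take_size in uN.
rewrite (eq_lexb (P' := fun k => G (nth s pre k) u)
   (Q' := fun k => G (nth s pre k) (nth s pre i))); first exact: Hl.
- by move=> k ki; rewrite En //; apply: ltn_trans il.
- by move=> k ki; rewrite !En //; apply: ltn_trans il.
Qed.

Lemma prefix_full : connected_graph G -> exists2 sigma, prefix_ok sigma & size sigma = n.
Proof.
move=> cG; have n0 : 0 < n by apply: leq_ltn_trans (ltn_ord s).
suff H k : k < n -> exists2 pre, prefix_ok pre & size pre = k.+1.
  by have [|pre ok sz] := H n.-1; [rewrite prednK|exists pre; rewrite // sz prednK].
elim: k => [_|k IH kn].
  exists [:: s] => //; split=> //=; first by rewrite inE.
    by move=> x; rewrite inE => /eqP->; rewrite eqxx.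
  by case.
have [pre ok sz] := IH (ltnW kn).
have [|c okc] := prefix_extend cG ok; first by rewrite sz.
by exists (rcons pre c); rewrite ?size_rcons ?sz.
Qed.

Lemma prefix_ldfs sigma : simple_graph G -> subrel T G ->
  prefix_ok sigma -> size sigma = n ->
  is_LDFS G sigma /\ forall x y, ltree G sigma x y = T x y.
Proof.
move=> [symG irrG] TG ok sz; have [us ss h0 Hp Hl] := ok.
have inS x : x \in sigma.
  have E : #|sigma| = #|'I_n| by rewrite card_ord (card_uniqP us) sz.
  by have /(subset_cardP E) -> : sigma \subset 'I_n by apply/subsetP.
have n0 : 0 < n by apply: leq_ltn_trans (ltn_ord s).
have idx_s : index s sigma = 0 by rewrite -{1}h0 index_uniq // sz.
split.
  split; first by rewrite /vertex_ordering us sz eqxx.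
  exists s => i il u uN; rewrite !ldfs_labelE ?sz 1?ltnW //.
  case: i il uN => [|i] il uN; first by rewrite /lab /= h0 eqxx; case: (u == s).
  have sT : s \in take i.+1 sigma.
    by rewrite in_take_leq ?idx_s // sz ltnW.
  have us' : u != s by apply: contraNneq uN => ->.
  have ns : nth s sigma i.+1 != s.
    by rewrite -{2}h0 nth_uniq // sz.
  by rewrite (negbTE us') (negbTE ns) !cats0 lex_lab; apply: Hl; rewrite ?sz.
have mono a x : panc s par a x -> a != x -> index a sigma < index x sigma.
  move=> ax ne; have [_ [E|//]] := prefix_panc ok ax (inS x).
  by rewrite E eqxx in ne.
have TP x : x != s -> T x (par x) by move=> xs; rewrite PS.2 xs eqxx.
(* By the first half of [check] the earlier neighbours of [x] are proper ancestors; the parent is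
   the latest of these and is adjacent to [x] because [T] is contained in [G]. *)
have lpE x y : ltree_parent G sigma x y = (x != s) && (y == par x).
  rewrite ltree_parentE //; apply/idP/andP => [/and3P[yx Gxy /forallP my]|[xs /eqP->]].
    have xs : x != s by apply: contraTneq yx => ->; rewrite idx_s.
    split=> //; have nyx : y != x by apply: contraTneq yx => ->; rewrite ltnn.
    have yax : panc s par y x.
      case/orP: (cs.1 _ _ Gxy) => /(visP PS) // /mono; rewrite eq_sym => /(_ nyx) lt.
      by have := ltn_trans lt yx; rewrite ltnn.
    have [_ yp] := panc_par yax nyx.
    apply/contraT => nyp; have [_ lt] := Hp x (inS x) xs.
    have := my (par x); rewrite (mono _ _ yp nyp) lt /=.
    by rewrite (TG _ _ (TP x xs)).
  have [_ lt] := Hp x (inS x) xs; rewrite lt (TG _ _ (TP x xs)) /=.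
  apply/forallP => w; apply/implyP => /andP[pw wx]; apply/negP => Gxw.
  have nwx : w != x by apply: contraTneq wx => ->; rewrite ltnn.
  case/orP: (cs.1 _ _ Gxw) => /(visP PS).
    move/mono; rewrite eq_sym => /(_ nwx) lt2.
    by have := ltn_trans lt2 wx; rewrite ltnn.
  move=> wax; have [_ wp] := panc_par wax nwx.
  have [_ [E|lt2]] := prefix_panc ok wp (inS _); first by rewrite E ltnn in pw.
  by have := ltn_trans lt2 pw; rewrite ltnn.
by move=> x y; rewrite /ltree !lpE PS.2.
Qed.

End Construction.

Lemma ldfs_ltreeP : connected_graph G -> spanning_tree G T ->
  LDFS_Ltree G T <-> exists s, check s.
Proof.
move=> cG sT; split=> [|[s cs]]; first exact: check_of_ldfs.
have [par [rk PS]] := spanning_tree_parents s sT.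
have [sigma ok sz] := prefix_full PS cs cG.
exists sigma; apply: (prefix_ldfs PS cs) => //; first by case: cG.
by case: sT => _ [].
Qed.

End Characterization.

(** * The recognition program *)

(* Variables are binding depths: 0 is the root, and every [CFor] and [FEx]
   binds the next number. *)
Definition c_start :=
  CFor (CFor (CAsg aVIS 1 2 (FAnd (FEq 2 0) (FNot (FEq 2 1))))).

(** A disjunction written by De Morgan: vertex 3 is already reached without entering vertex 2, or
    differs from 2 and has a reached neighbour 4 in the tree. *)
Definition f_step :=
  FNot (FAnd (FNot (FRel aVIS 2 3))
    (FNot (FAnd (FNot (FEq 3 2)) (FEx (FAnd (FRel aVIS 2 4) (FRel aT 4 3)))))).

Definition c_round := CFor (CFor (CAsg aVIS 2 3 f_step)).

Definition c_vis := CSeq c_start (CFor c_round).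

Definition f_edges :=
  FNot (FEx (FEx (FAnd (FRel aIN 1 2) (FAnd (FRel aVIS 1 2) (FRel aVIS 2 1))))).

(** Variables 1, 2, 3 and 4 are [c], [x], [a] and [d] of [check]. *)
Definition f_label_gap :=
  FNot (FEx (FAnd (FNot (FRel aVIS 3 4)) (FAnd (FNot (FRel aVIS 4 1))
    (FAnd (FRel aIN 4 1) (FNot (FRel aIN 4 2)))))).

Definition f_labels :=
  FNot (FEx (FEx (FEx
    (FAnd (FNot (FRel aVIS 1 2)) (FAnd (FNot (FRel aVIS 3 1))
    (FAnd (FNot (FEq 3 1)) (FAnd (FRel aIN 3 2)
    (FAnd (FNot (FRel aIN 3 1)) f_label_gap)))))))).

Definition f_check := FAnd f_edges f_labels.

Definition try_root := Seq (ccomp 1 c_vis) (fcomp 1 f_check).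

Definition main := Seq prepare (Exists (vr 0) (And (Test aRS (vr 0)) try_root)).

Lemma main_wf : wf ntracks nregs main. Proof. by []. Qed.

Section Program.
Variable n : nat.
Implicit Types (rho : nat -> nat -> nat -> bool) (env : nat -> nat).

Lemma has_ord (phi : pred nat) : has phi (iota 0 n) = [exists x : 'I_n, phi x].
Proof.
apply/hasP/existsP => [[x]|[x Hx]]; last by exists (val x); rewrite // mem_iota /=.
by rewrite mem_iota add0n => xn Hx; exists (Ordinal xn).
Qed.

Lemma foldl_iota_ind A (F : A -> nat -> A) (P : nat -> A -> Prop) x :
  P 0 x -> (forall (k : 'I_n) t, P k t -> P k.+1 (F t k)) -> P n (foldl F x (iota 0 n)).
Proof.
move=> P0 PS; suff H k : k <= n -> P k (foldl F x (iota 0 k)) by apply: H.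
elim: k => // k IH kn; have -> : iota 0 k.+1 = iota 0 k ++ [:: k] by rewrite -addn1 iotaD.
rewrite foldl_cat /=; exact: (PS (Ordinal kn) _ (IH (ltnW kn))).
Qed.

Lemma csem_frame d env c rho A : A \notin carr c -> csem n d env c rho A = rho A.
Proof.
elim: c d env rho => [B x y f|c1 IH1 c2 IH2|c IH] d env rho /=.
- by rewrite inE /updmat => /negbTE->.
- by rewrite mem_cat negb_or => /andP[H1 H2]; rewrite IH2 // IH1.
by move=> H; apply: (@foldl_iota_ind _ _ (fun _ r => r A = rho A)) => // k r; rewrite IH.
Qed.

Variables (T : rel 'I_n) (s : 'I_n).
Let e (a : 'I_n) := [rel u v : 'I_n | T u v && (v != a)].

Lemma c_start_correct env rho (a x : 'I_n) : env 0 = s ->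
  csem n 1 env c_start rho aVIS a x = (x == s) && (x != a).
Proof.
move=> es; pose Q (r : nat -> nat -> nat -> bool) (a x : 'I_n) := r aVIS a x = (x == s) && (x != a).
pose r0 := csem n 1 env c_start rho.
suff H : forall a' : 'I_n, a' < n -> forall x', Q r0 a' x' by apply: H.
rewrite {}/r0 [csem _ _ _ _ _]/=.
apply: (@foldl_iota_ind _ _ (fun k r => forall a' : 'I_n, a' < k -> forall x', Q r a' x')) => // k r Hr.
set r1 := foldl _ _ _.
suff H : forall x' : 'I_n, (forall a' : 'I_n, a' < k -> forall x', Q r1 a' x') /\ (x' < n -> Q r1 k x').
  move=> a'; rewrite ltnS leq_eqVlt => /orP[/eqP/val_inj->|lt] x'; first by apply: (H x').2.
  exact: (H x').1.
rewrite {}/r1.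
apply: (@foldl_iota_ind _ _ (fun l r => forall x' : 'I_n,
  (forall a' : 'I_n, a' < k -> forall x', Q r a' x') /\ (x' < l -> Q r k x'))) => // l r' Hr' x'.
have [H1 H2] := Hr' x'.
rewrite /bind /=; split=> [a' lt y|].
  rewrite /Q /updmat /= ifF; first exact: H1.
  by apply/negbTE; rewrite negb_and; apply/orP; left; rewrite neq_ltn lt.
rewrite ltnS leq_eqVlt => /orP[/eqP/val_inj->|lt].
  by rewrite /Q /updmat /= !eqxx /= es.
have := H2 lt; rewrite /Q /updmat /= ifF //.
by rewrite eqxx /=; apply/negbTE; rewrite neq_ltn lt.
Qed.

Definition sound rho := forall a x : 'I_n, rho aVIS a x -> vis T s a x.
Definition step_done rho rho' (a y : 'I_n) :=
  forall x : 'I_n, rho aVIS a x -> T x y -> y != a -> rho' aVIS a y.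

(** Entries are updated in place, so a round may reach further than one step. Instead of an exact
    value the lemma gives two bounds: whatever is set is reachable, and at least one step has been
    made. *)
Lemma c_round_correct env rho :
  (forall x y : 'I_n, rho aT x y = T x y) -> sound rho ->
  let rho' := csem n 2 env c_round rho in
  [/\ sound rho', forall a x : 'I_n, rho aVIS a x -> rho' aVIS a x
    & forall a y, step_done rho rho' a y].
Proof.
move=> HT Hs; rewrite /=.
pose Inv (r : nat -> nat -> nat -> bool) := [/\ sound r, forall a x : 'I_n, rho aVIS a x -> r aVIS a x & r aT = rho aT].
suff [[H1 H2 _] H3] : Inv (csem n 2 env c_round rho) /\
    (forall a : 'I_n, a < n -> forall y, step_done rho (csem n 2 env c_round rho) a y).
  by split=> // a; apply: H3.
rewrite [csem _ _ _ _ _]/=.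
apply: (@foldl_iota_ind _ _ (fun k r => Inv r /\ (forall a : 'I_n, a < k -> forall y, step_done rho r a y))) => // k r [Ir Hr].
suff [Ir' Hr' Hk] : let r' := foldl (fun r l =>
      csem n 4 (bind (bind env 2 k) 3 l) (CAsg aVIS 2 3 f_step) r) r (iota 0 n) in
    [/\ Inv r', (forall a : 'I_n, a < k -> forall y, step_done rho r' a y)
      & forall y : 'I_n, y < n -> step_done rho r' k y].
  split=> // a; rewrite ltnS leq_eqVlt => /orP[/eqP/val_inj->|]; last exact: Hr'.
  by move=> y; apply: Hk.
apply: (@foldl_iota_ind _ _ (fun l r' => [/\ Inv r',
   (forall a : 'I_n, a < k -> forall y, step_done rho r' a y)
    & forall y : 'I_n, y < l -> step_done rho r' k y])) => // l r' [[I1 I2 I3] Hr' Hl].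
rewrite /= /bind /= has_ord.
set b := ~~ _.
have bP : b = r' aVIS k l || (l != k) && [exists x : 'I_n, r' aVIS k x && T x l].
  rewrite /b negb_and !negbK; congr (_ || (_ && _)).
  by apply: eq_existsb => x; rewrite I3 HT.
have mono (a x : 'I_n) : r' aVIS a x -> updmat r' aVIS k l b aVIS a x.
  rewrite /updmat /=; case: ifP => // /andP[/eqP/val_inj-> /eqP/val_inj->] H.
  by rewrite bP H.
have mono_done a y : step_done rho r' a y -> step_done rho (updmat r' aVIS k l b) a y.
  by move=> H x Hx Txy ya; apply/mono/(H x).
split; [split|..] => //.
- move=> a x; rewrite /updmat /=; case: ifP => [/andP[/eqP/val_inj-> /eqP/val_inj->]|_]; last exact: I1.
  rewrite bP => /orP[/I1//|/andP[lk /existsP[z /andP[/I1/andP[sk Hc] Tzl]]]].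
  by rewrite /vis sk; apply: connect_trans Hc (connect1 _); rewrite Tzl.
- by move=> a x /I2; apply: mono.
- by move=> a lt y; apply/mono_done/Hr'.
move=> y; rewrite ltnS leq_eqVlt => /orP[/eqP/val_inj->|lt]; last exact/mono_done/Hl.
move=> x Hx Txl lk; rewrite /updmat /= !eqxx bP lk; apply/orP; right; apply/existsP.
by exists x; rewrite I2.
Qed.

Lemma c_vis_correct env rho : env 0 = s -> (forall x y : 'I_n, rho aT x y = T x y) ->
  forall a x : 'I_n, csem n 1 env c_vis rho aVIS a x = vis T s a x.
Proof.
move=> es HT; rewrite [csem _ _ _ _ _]/= -/(csem n 1 env c_start rho).
set rho1 := csem n 1 env c_start rho.
have H1 (a x : 'I_n) : rho1 aVIS a x = (x == s) && (x != a) by apply: c_start_correct.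
have HT1 (x y : 'I_n) : rho1 aT x y = T x y by rewrite /rho1 csem_frame.
pose Inv k (r : nat -> nat -> nat -> bool) := [/\ forall x y : 'I_n, r aT x y = T x y, sound r &
   forall (a : 'I_n) p, s != a -> path (e a) s p -> size p <= k -> r aVIS a (last s p)].
suff [_ Hs Hc] : Inv n (foldl (fun r k => csem n 2 (bind env 1 k) c_round r) rho1 (iota 0 n)).
  move=> a x; apply/idP/idP => [/Hs//|/andP[sa /connectP[p Hp ->]]].
  (* A path without repetitions has fewer than [n] edges, so [n] rounds reach its end. *)
  case/shortenP: Hp => p' Hp' up' _; apply: Hc => //.
  have := max_card (mem (s :: p')); rewrite (card_uniqP up') card_ord /=; exact: ltnW.
apply: foldl_iota_ind => [|k r [HTr Hs Hc]].
  split=> // [a x|a p sa _].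
    rewrite H1 => /andP[/eqP-> sa]; by rewrite /vis sa connect0.
  by rewrite leqn0 size_eq0 => /eqP->; rewrite /= H1 eqxx.
have [R1 R2 R3] := c_round_correct (bind env 1 k) HTr Hs.
split=> // [x y|a p sa]; first by rewrite csem_frame.
case/lastP: p => [_ _|p y]; first by apply: R2; apply: (Hc a [::]).
rewrite rcons_path size_rcons ltnS last_rcons => /andP[Hp /andP[Ty ya]] szp.
by apply: (R3 a y (last s p)) => //; apply: Hc.
Qed.

Variable G : rel 'I_n.

Lemma try_root_correct env rho : env 0 = s ->
  (forall x y : 'I_n, rho aIN x y = G x y) ->
  (forall x y : 'I_n, rho aT x y = T x y) ->
  reflect (check G T s) (fsem n 1 env (csem n 1 env c_vis rho) f_check).
Proof.
move=> es HG HT; have HV := c_vis_correct es HT.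
have HG' (x y : 'I_n) : csem n 1 env c_vis rho aIN x y = G x y by rewrite csem_frame.
move: (csem _ _ _ _ _) HV HG' => r HV HG'.
have exE (phi : pred nat) : reflect (exists x : 'I_n, phi x) (has phi (iota 0 n)).
  by rewrite has_ord; apply: existsP.
apply: (iffP andP) => [[/exE H1 /exE H2]|[H1 H2]].
  split=> [x y Gxy|c x a cx ac neq Gax nGac].
    rewrite -negb_and; apply/negP => /andP[xy yx]; apply: H1; exists x; apply/exE; exists y.
    by rewrite /= /bind /= HG' !HV Gxy xy.
  have [[d Hd]|nex] := exE (fun d => [&& ~~ r aVIS a d, ~~ r aVIS d c, r aIN d c & ~~ r aIN d x]).
    by exists d; rewrite -!HV -!HG'.
  case: H2; exists c; apply/exE; exists x; apply/exE; exists a.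
  rewrite /= /bind /= !HG' !HV cx ac Gax nGac -val_eqE in neq *.
  by rewrite neq; apply/negP => /exE.
split; apply/exE.
  case=> x /exE[y]; rewrite /= /bind /= HG' !HV => /and3P[Gxy xy yx].
  by have := H1 x y Gxy; rewrite xy yx.
case=> c /exE[x /exE[a]]; rewrite /= /bind /= !HG' !HV.
case/and5P => cx ac neq Gax /andP[nGac /negP nex].
have [|d Hd] := H2 c x a cx ac _ Gax nGac; first by [].
by apply: nex; apply/exE; exists d; rewrite !HG' !HV.
Qed.

End Program.

(** * Encodings *)

Lemma nth_allpairs_grid (A B C : Type) (f : A -> B -> C) x0 y0 z0 (u : seq A) (v : seq B) i j :
  i < size u -> j < size v ->
  nth z0 [seq f x y | x <- u, y <- v] (i * size v + j) = f (nth x0 u i) (nth y0 v j).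
Proof.
move=> iu jv; elim: u i iu => // x u IH [|i] iu /=; rewrite nth_cat size_map.
  by rewrite mul0n jv (nth_map y0).
rewrite mulSn -addnA ltnNge leq_addr /= addKn; exact: IH.
Qed.

Definition symbol_bits (c : 'I_4) t :=
  (t == aIN) && (c == sym_1) || (t == aSEP) && (c == sym_sep).

Section Encode.
Variables (n : nat) (G T : rel 'I_n).
Let N := n * n + (n * n).+1.

Lemma size_enc_rel (R : rel 'I_n) : size (enc_rel R) = n * n.
Proof. by rewrite size_allpairs size_enum_ord. Qed.

Lemma size_encode : size (encode G T) = N.
Proof. by rewrite size_cat /= !size_enc_rel. Qed.

Lemma nth_enc_rel (R : rel 'I_n) (i j : 'I_n) :
  nth sym_blank (enc_rel R) (i * n + j) = bit (R i j).
Proof.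
have := @nth_allpairs_grid _ _ _ (fun i j => bit (R i j)) i j sym_blank (enum 'I_n) (enum 'I_n) i j.
by rewrite size_enum_ord !nth_ord_enum; apply.
Qed.

Lemma enc_rel_bits (R : rel 'I_n) c : c \in enc_rel R -> c \in [:: sym_0; sym_1].
Proof. by case/allpairsP => p [_ _ ->]; case: (R _ _). Qed.

Lemma encode_nonblank : sym_blank \notin encode G T.
Proof.
by rewrite mem_cat inE; apply/negP => /or3P[/enc_rel_bits|//|/enc_rel_bits].
Qed.

Let st0 := init_state symbol_bits (encode G T).

Lemma init_G (i j : 'I_n) : arr st0 aIN (i * n + j) = G i j.
Proof.
have lt := cell_lt (ltn_ord i) (ltn_ord j).
by rewrite /= nth_cat size_enc_rel lt nth_enc_rel /symbol_bits; case: (G i j).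
Qed.

Lemma init_T (i j : 'I_n) : arr st0 aIN ((n * n).+1 + (i * n + j)) = T i j.
Proof.
rewrite /= nth_cat size_enc_rel ltnNge addSn -addnS leq_addr addKn /=.
by rewrite nth_enc_rel /symbol_bits; case: (T i j).
Qed.

Lemma init_sep p : p < N -> arr st0 aSEP p = (p == n * n).
Proof.
move=> pN; rewrite /= nth_cat size_enc_rel /symbol_bits /=.
have bitP (R : rel 'I_n) k : k < n * n -> (nth sym_blank (enc_rel R) k == sym_sep) = false.
  move=> kn; have Hk : nth sym_blank (enc_rel R) k \in enc_rel R.
    by rewrite mem_nth // size_enc_rel.
  by have := enc_rel_bits Hk; rewrite !inE => /orP[/eqP->|/eqP->].
case: ltnP => lt; first by rewrite bitP // ltn_eqF.
case E: (p - n * n) => [|k] /=; first by rewrite eqxx eqn_leq lt -subn_eq0 E.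
rewrite bitP; last by rewrite /N in pN; lia.
by rewrite gtn_eqF // -subn_gt0 E.
Qed.

Lemma main_correct : connected_graph G -> spanning_tree G T ->
  (eval nregs N main st0).1 <-> LDFS_Ltree G T.
Proof.
move=> cG sT; rewrite ldfs_ltreeP // /main eval_Seq.
have [gd EIN ET] := prepare_spec (erefl : reg st0 0 = 0) init_sep
  (fun p _ => erefl : arr st0 aRS p = false) (fun p _ => erefl : arr st0 aT p = false).
rewrite -/N in gd EIN ET *.
move: (eval nregs N prepare st0).2 gd EIN ET => st1 gd EIN ET.
have relG st : arr st aIN = arr st1 aIN -> forall x y : 'I_n, mat n st aIN x y = G x y.
  by move=> E x y; rewrite /mat !ltn_ord E EIN init_G.
have relT st : arr st aT = arr st1 aT -> forall x y : 'I_n, mat n st aT x y = T x y.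
  by move=> E x y; rewrite /mat !ltn_ord E /= ET ?init_T // cell_lt.
pose env v := bind (fun=> 0) 0 v.
pose psi v := fsem n 1 (env v) (csem n 1 (env v) c_vis (mat n st1)) f_check.
have psiP (s : 'I_n) st : arr st aIN = arr st1 aIN -> arr st aT = arr st1 aT ->
    reflect (check G T s) (fsem n 1 (env s) (csem n 1 (env s) c_vis (mat n st)) f_check).
  by move=> E1 E2; apply: try_root_correct => //; [apply: relG|apply: relT].
(* [c_start] assigns every entry of [aVIS], so nothing left by an earlier root affects a later
   verdict: it depends on the two matrices alone and may be computed from [st1]. *)
pose Inv (p : nat) s := [/\ good n s, arr s aIN = arr st1 aIN & arr s aT = arr st1 aT].
have N0 : 0 < N by rewrite /N; lia.
pose phi p := [&& p < n * n, n %| p & psi (p %/ n)].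
have [|||||-> _] // := @exists_spec nregs N N0 (vr 0) (And (Test aRS (vr 0)) try_root) st1 phi Inv.
- by case: gd.
- move=> p s pN rp _ [gs E1 E2].
  have -> : eval nregs N (And (Test aRS (vr 0)) try_root) s
     = if (p < n * n) && (n %| p) then eval nregs N try_root s else (false, s).
    have [_ rs] := gs; rewrite [LHS]/= -/(eval nregs N try_root) /track /= rp rs //.
    by case: (_ && _).
  rewrite /phi andbA; case: (boolP (_ && _)) => // /andP[pn /dvdnP[m Em]].
  have n0 : 0 < n by lia.
  have vn : p %/ n < n by rewrite ltn_divLR.
  have ok : env_ok n 1 (env (p %/ n)) s.
    by move=> [|//] _; split=> //; rewrite rp Em mulnK.
  have gs1 : good n (eval nregs N (ccomp 1 c_vis) s).2 by apply: good_ccomp.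
  have ok1 : env_ok n 1 (env (p %/ n)) (eval nregs N (ccomp 1 c_vis) s).2.
    by apply: env_ok_frame ok => l; apply: vr_wreg_ccomp.
  have FR a : a \in [:: aIN; aT] -> arr (eval nregs N try_root s).2 a = arr s a.
    by move=> Ha; apply: eval_arr; move: Ha; rewrite !inE => /orP[/eqP->|/eqP->].
  split; last by move=> _; split; [apply: good_frame|rewrite FR|rewrite FR].
  rewrite /try_root eval_Seq (fcomp_correct _ gs1 ok1) // (ccomp_correct _ gs ok) //=.
  exact: (sameP (psiP (Ordinal vn) s E1 E2) (psiP (Ordinal vn) st1 erefl erefl)).
rewrite has_rows has_ord; split=> [/existsP[s /(psiP s st1 erefl erefl)]|[s Hs]]; first by exists s.
by apply/existsP; exists s; apply/(psiP s st1).
Qed.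

End Encode.

(** * The recognizing machine and its running time *)

Definition recognizer : mach :=
  seqm (load ntracks nregs symbol_bits) (compile ntracks main).

Lemma recognizer_runs w : sym_blank \notin w -> 0 < size w ->
  exists tp', mruns recognizer ([::], head sym_blank w, behead w)
    (eval nregs (size w) main (init_state symbol_bits w)).1 tp'
    (load_cost ntracks w + cost ntracks main (size w)).
Proof.
move=> nb n0.
have blk0 c t : t < nregs -> symbol_bits c t = false.
  by move=> lt; rewrite /symbol_bits !ltn_eqF // ltnW.
have HL := load_correct (K := ntracks) (KR := nregs) isT isT blk0 nb n0.
have HC := @compile_correct ntracks nregs isT isT (size w) main (init_state symbol_bits w)
  main_wf (fun r _ => n0).
have [tp' _ M] := grunsP (gruns_seq HL (gruns_toP HC) (leqnn _)) (erefl _).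
by exists tp'.
Qed.

(** With [w] of length [2 * n * n + 1], [(size w).+1] is at most twice the square of [(n + e).+1];
    this gives the factor [2 ^ (k + 2)] and the doubled exponent. The exponent [k + 2] dominates
    both the program and the square in [load_cost], whose coefficients add up to [220]. *)
Lemma recognizer_time : exists c k, forall n e (w : seq 'I_4),
  size w = n * n + (n * n).+1 ->
  load_cost ntracks w + cost ntracks main (size w) <= c * (n + e).+1 ^ k.
Proof.
have [c [k Hc]] := cost_poly ntracks main.
exists ((220 * (ntracks + 1) ^ 2 + c) * 2 ^ (k + 2)), (2 * (k + 2)) => n e w sw.
have lN : (size w).+1 <= 2 * (n + e).+1 ^ 2 by rewrite sw -mulnn; nia.
apply: (@leq_trans ((220 * (ntracks + 1) ^ 2 + c) * (size w).+1 ^ (k + 2))); last first.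
  by rewrite -mulnA leq_mul2l expnM -expnMn leq_exp2r ?lN ?orbT //; lia.
rewrite mulnDl leq_add //; last first.
  by apply: leq_trans (Hc _) _; rewrite leq_mul2l leq_pexp2l ?orbT //; lia.
apply: (@leq_trans (220 * (ntracks + 1) ^ 2 * (size w).+1 ^ 2)).
  rewrite /load_cost; move: (size w) => N.
  have : N.+1 <= N.+1 ^ 2 by rewrite -mulnn leq_pmulr.
  move: (N.+1 ^ 2) ((ntracks + 1) ^ 2) => M A leNM.
  have -> : 220 * A * M = 20 * A * M + 200 * A * M by lia.
  by rewrite leq_add2l leq_mul2l leNM orbT.
by rewrite leq_mul2l leq_pexp2l ?orbT //; lia.
Qed.

(* There is a Turing machine M and a polynomial bound c * (|V|+|E|+1)^k
   such that on every instance (G, T), G connected and T a spanning tree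
   of G, M halts within that many steps, accepting iff T is the L-tree of
   some LDFS ordering of G. *)
Theorem theorem1 :
  exists (M : TM) (c k : nat),
    tm_acc M != tm_rej M /\
    forall (n : nat) (G T : rel 'I_n),
      connected_graph G -> spanning_tree G T ->
      let st := (tm_run M (c * (n + nedges G).+1 ^ k) (encode G T)).1 in
      (st = tm_acc M /\ LDFS_Ltree G T) \/ (st = tm_rej M /\ ~ LDFS_Ltree G T).
Proof.
have [c [k time]] := recognizer_time.
exists (TM_of recognizer), c, k; split=> [|n G T cG sT]; first exact: TM_acc_rej.
set t := c * _; have sz := size_encode G T.
have w0 : 0 < size (encode G T) by rewrite sz addnS.
have [tp' [j lej Ej]] := recognizer_runs (encode_nonblank G T) w0.
have M : mruns recognizer ([::], head sym_blank (encode G T), behead (encode G T)) _ tp' t :=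
  ex_intro2 _ _ j (leq_trans lej (time _ _ _ sz)) Ej.
rewrite (TM_run_exit M) sz; have := main_correct cG sT.
case: (eval _ _ _ _).1 => -[H1 H2]; [left|right]; split=> //; first exact: H1.
by move=> /H2.
Qed.
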